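(* Let $k\ge 2$ be an integer and let $a,b,c\in\mathbb{R}$. Assume that $T>0$, $s>5/2$ and $u\in C([0,T];H^s)$ is a strong solution of the $k$-$abc$ equation \begin{align*} u_t &+u^ku_x-au^{k-2}u_x^3+D^{-2}\partial_x\left[\frac{b}{k+1}u^{k+1}+cu^{k-1}u_x^2-a(k-2)u^{k-3}u_x^4\right]\\ &+D^{-2}\left[\bigl(k(k+2)-8a-b-c(k+1)\bigr)u^{k-2}u_x^3-3a(k-2)u^{k-3}u_x^3u_{xx}\right]=0,\qquad x\in\mathbb{R}, \end{align*} with initial data $u_0(x)=u(x,0)$. If the initial data satisfies certain decay conditions at infinity, more precisely, if there is some $\theta\in(0,1)$ such that $$|u_0|,\ |\partial_xu_0| \sim O(e^{-\theta|x|})\quad\text{as } |x|\to\infty,$$ then $$|u(x,t)|,\ |\partial_xu(x,t)| \sim O(e^{-\theta|x|})\quad\text{as } |x|\to\infty$$ uniformly with respect to $t\in[0,T]$. Here $\sim O(\cdot)$ has the meaning given in the context (existence of a positive limit of the quotient), not the usual upper-bound meaning.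
   Context: $D^{-2}=(1-\partial_x^2)^{-1}$ on $\mathbb{R}$, i.e. $D^{-2}f=G*f$ with $G(x)=\frac12e^{-|x|}$. $H^s=H^s(\mathbb{R})$ is the $L^2$-based Sobolev space, and $u$ is real-valued. When $k=2$, the terms carrying the coefficient $k-2$ are absent (zero), and $u^{k-2}=1$. A strong solution $u\in C([0,T];H^s)$ is one for which $u_t\in C([0,T];H^{s-1})$ and the equation holds on $[0,T]$. Notation: one writes $|f(x)|\sim O(e^{\alpha x})$ as $x\to\infty$ if $\lim_{x\to\infty}\frac{|f(x)|}{e^{\alpha x}}=L$ for some $L>0$; the notation $|f(x)|\sim O(e^{-\theta|x|})$ as $|x|\to\infty$ is understood in the same way, i.e. $\lim_{|x|\to\infty}\frac{|f(x)|}{e^{-\theta|x|}}=L$ for some $L>0$. *)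

(* Defs.v *)
From HB Require Import structures.
From mathcomp Require Import all_boot all_order all_algebra.
From mathcomp Require Import all_classical all_reals all_analysis.
Set Implicit Arguments.
Unset Strict Implicit.
Unset Printing Implicit Defensive.
Import Order.TTheory GRing.Theory Num.Theory.
Import numFieldNormedType.Exports.
Local Open Scope classical_set_scope.
Local Open Scope ring_scope.

Section Sobolev.
Context {R : realType}.
Local Notation mu := (@lebesgue_measure R).
Implicit Types (f g phi : R -> R) (u v : R -> R -> R) (s T : R).

Definition schwartz phi : Prop :=
  (forall (n : nat) (x : R), derivable (derive1n n phi) x 1) /\
  (forall m n : nat, exists C : R,
     forall x : R, `|x ^+ m * derive1n n phi x| <= C).

Definition cos_transform phi (xi : R) : R :=
  \int[mu]_x (phi x * cos (x * xi)).
Definition sin_transform phi (xi : R) : R :=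
  \int[mu]_x (phi x * sin (x * xi)).

(* [fourier_of f h]: the complex function [h.1 + i h.2] is the Fourier
   transform of the real function [f] in L^2, with the kernel exp(-i x xi).
   It is the transform of [f] as a tempered distribution:
     <f^, phi> = <f, phi^>  for every Schwartz function phi,
   separated into real and imaginary parts; real-valued test functions
   suffice by linearity. *)
Definition fourier_of f (h : (R -> R) * (R -> R)) : Prop :=
  [/\ f \in Lfun mu 2%:E, h.1 \in Lfun mu 2%:E, h.2 \in Lfun mu 2%:E &
   forall phi, schwartz phi ->
     \int[mu]_xi (h.1 xi * phi xi) = \int[mu]_x (f x * cos_transform phi x) /\
     \int[mu]_xi (h.2 xi * phi xi) = - \int[mu]_x (f x * sin_transform phi x)].

(* Unique up to a null set; arbitrary if [f] is not in L^2. *)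
Definition fourier f : (R -> R) * (R -> R) := get [set h | fourier_of f h].

(* The L^2 norm of (1 + xi^2)^(s/2) |f^(xi)|. *)
Definition Hs_norm s f : \bar R :=
  Lnorm mu 2%:E (fun xi : R =>
    ((1 + xi ^+ 2) `^ (s / 2) *
     Num.sqrt ((fourier f).1 xi ^+ 2 + (fourier f).2 xi ^+ 2))%:E).

(* H^s(R) for s >= 0, where its elements are L^2 functions. *)
Definition Hs s f : Prop :=
  (exists h, fourier_of f h) /\ (Hs_norm s f < +oo)%E.

(* Time is the first argument: [u t x] is u(x,t). *)
Definition C_Hs s T u : Prop :=
  (forall t, t \in `[0, T] -> Hs s (u t)) /\
  (forall t0, t0 \in `[0, T] ->
     Hs_norm s (fun x => u t x - u t0 x)
       @[t --> within `[0, T] (nbhs t0)] --> 0%E).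

(* [v] is the time derivative u_t on [0,T], the difference quotients (one-sided
   at the end points) converging in H^s. *)
Definition Hs_time_derivative s T u v : Prop :=
  forall t0, t0 \in `[0, T] ->
    Hs_norm s (fun x => (u t x - u t0 x) / (t - t0) - v t0 x)
      @[t --> within `[0, T] t0^'] --> 0%E.

(* D^{-2} = (1 - d^2/dx^2)^{-1}, convolution with exp(-|x|)/2. *)
Definition Dm2 f (x : R) : R :=
  \int[mu]_y (2^-1 * expR (- `|x - y|) * f y).

End Sobolev.

Section KABC.
Context {R : realType}.
Local Notation mu := (@lebesgue_measure R).
Implicit Types (k : nat) (a b c : R) (w : R -> R).

(* For k = 2 the truncated exponent k - 3 is harmless: it only occurs with the
   vanishing coefficient k - 2. *)
Definition kabc_flux k a b c w (x : R) : R :=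
  b / (k%:R + 1) * w x ^+ (k + 1)
  + c * w x ^+ (k - 1) * derive1 w x ^+ 2
  - a * (k%:R - 2) * w x ^+ (k - 3) * derive1 w x ^+ 4.

Definition kabc_source k a b c w (x : R) : R :=
  (k%:R * (k%:R + 2) - 8 * a - b - c * (k%:R + 1))
    * w x ^+ (k - 2) * derive1 w x ^+ 3
  - 3 * a * (k%:R - 2) * w x ^+ (k - 3) * derive1 w x ^+ 3 * derive1n 2 w x.

(* The left-hand side of the equation without the term u_t. *)
Definition kabc_spatial k a b c w (x : R) : R :=
  w x ^+ k * derive1 w x - a * w x ^+ (k - 2) * derive1 w x ^+ 3
  + Dm2 (derive1 (kabc_flux k a b c w)) x
  + Dm2 (kabc_source k a b c w) x.

(* A strong solution in C([0,T]; H^s), s > 5/2. The class of [u t] in H^s is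
   represented by its continuous representative, so that [u t x] and
   [derive1 (u t) x] are the usual pointwise values. The equation is an identity in
   H^(s-1), that is, almost everywhere in x for every t. *)
Definition kabc_strong_solution k a b c (s T : R) (u : R -> R -> R) : Prop :=
  [/\ C_Hs s T u,
      forall t, t \in `[0, T] -> continuous (u t) &
      exists ut : R -> R -> R,
        [/\ C_Hs (s - 1) T ut,
            Hs_time_derivative (s - 1) T u ut &
            forall t, t \in `[0, T] ->
              {ae mu, forall x, ut t x + kabc_spatial k a b c (u t) x = 0}]].

(* |f(x)| / exp(-theta |x|) tends to one and the same L > 0 at +oo and -oo. *)
Definition exp_decay (theta : R) (f : R -> R) : Prop :=
  exists2 L : R, 0 < L &
    `|f x| / expR (- (theta * `|x|)) @[x --> +oo] --> L /\
    `|f x| / expR (- (theta * `|x|)) @[x --> -oo] --> L.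

(* The same for every [f t], t in [A], the limit being uniform in t. *)
Definition exp_decay_uniform (A : set R) (theta : R) (f : R -> R -> R) : Prop :=
  exists2 L : R -> R, (forall t, A t -> 0 < L t) &
    forall eps : R, 0 < eps -> exists M : R, forall t x : R,
      A t -> M < `|x| ->
      `| `|f t x| / expR (- (theta * `|x|)) - L t | < eps.

End KABC.

(* Main.v *)
Require Import Defs.
From HB Require Import structures.
From mathcomp Require Import all_boot all_order all_algebra.
From mathcomp Require Import all_classical all_reals all_analysis.
From mathcomp Require Import measurable_realfun zify ring lra.
Set Implicit Arguments.
Unset Strict Implicit.
Unset Printing Implicit Defensive.
Import Order.TTheory GRing.Theory Num.Theory.
Import numFieldNormedType.Exports.
Local Open Scope classical_set_scope.
Local Open Scope ring_scope.

(** The equation reads u_t = - N(u), where N(u) consists of local terms and of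
    convolutions with exp(-|x|)/2 or its derivative.  Write p = |u| + |u_x|.  Each
    term of N(u) and of its derivative in x has degree at least two in (u, u_x),
    up to a linear factor u_xx.  If u, u_x and u_xx are bounded on the strip
    [0,T] x R, it follows that |u_t| and |u_xt| are at most C (p^2 + G * p^2) with
    G = exp(-|x|) ([kabc_spatial_le]).

    Decay passes through these bounds because convolution with G preserves the
    weights exp(-theta |x|) for theta < 1 ([Dm2_abs_exp_weight]).  As p^2 is at
    most a constant times p, Gronwall's inequality in a weighted supremum norm
    gives p <= K exp(-theta |x|) uniformly in time ([exp_weighted_bound]).  Then
    p^2 decays at the rate 2 theta, so u_t and u_xt decay at some rate larger
    than theta.  Therefore u(t) - u_0 and u_x(t) - (u_0)_x are of smaller order
    than exp(-theta |x|), and the limits of the quotients for the initial data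
    are also the limits at all later times ([kabc_persistence]).

    This argument works pointwise in x, and it remains to see that a strong
    solution is a classical one.  Testing the distributional Fourier transform
    against modulated Gaussians gives the inversion formula for continuous square
    integrable functions with integrable transform ([fourier_inversion]); with
    the Cauchy-Schwarz inequality it yields the embedding of H^s into C^n for
    n + 1/2 < s ([sobolev_embedding]).  Since s > 5/2, the slices u(t) are bounded
    in C^2 uniformly in t ([slices_C2_bounded]).  Since s - 1 > 3/2, the difference
    quotients in time converge in C^1, so the equation and its derivative in x
    hold at every point ([slice_time_derivative]). *)

(** * Derivatives and integrals on the line *)

Section calculus.
Context {R : realType}.
Implicit Types (f g : R -> R) (x a b c : R).

Lemma is_derive1D f g x a b : is_derive x 1 f a -> is_derive x 1 g b ->
  is_derive x 1 (fun z => f z + g z) (a + b).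
Proof. by move=> fa gb; exact: is_deriveD. Qed.

Lemma is_derive1N f x a : is_derive x 1 f a ->
  is_derive x 1 (fun z => - f z) (- a).
Proof. by move=> fa; exact: is_deriveN. Qed.

Lemma is_derive1B f g x a b : is_derive x 1 f a -> is_derive x 1 g b ->
  is_derive x 1 (fun z => f z - g z) (a - b).
Proof. by move=> fa gb; exact: is_deriveB. Qed.

Lemma is_derive1M f g x a b : is_derive x 1 f a -> is_derive x 1 g b ->
  is_derive x 1 (fun z => f z * g z) (a * g x + f x * b).
Proof.
move=> fa gb; apply: (is_derive_eq (is_deriveM fa gb)).
by rewrite addrC /GRing.scale/= [g x * a]mulrC.
Qed.

Lemma is_derive1Z f x c a : is_derive x 1 f a ->
  is_derive x 1 (fun z => c * f z) (c * a).
Proof. by move=> fa; exact: is_deriveZ. Qed.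

Lemma is_derive1X f n x a : is_derive x 1 f a ->
  is_derive x 1 (fun z => f z ^+ n) (n%:R * f x ^+ n.-1 * a).
Proof.
move=> fa; have := is_deriveX n fa; rewrite /GRing.scale/= => h.
rewrite (_ : (fun z => _) = f ^+ n)//.
by apply/funext => z; rewrite fctE.
Qed.

Lemma is_derive1_cst c x : is_derive x 1 (fun=> c) 0.
Proof. exact: is_derive_cst. Qed.

Lemma is_derive1_id x : is_derive x 1 (fun z => z) 1.
Proof. exact: is_derive_id. Qed.

Lemma is_derive1_lin c x : is_derive x 1 (fun z => c * z) c.
Proof. exact: (is_derive_eq (is_derive1Z c (is_derive1_id x)) (mulr1 c)). Qed.

Lemma is_derive1_expR f x a : is_derive x 1 f a ->
  is_derive x 1 (fun z => expR (f z)) (expR (f x) * a).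
Proof. by move=> fa; exact: is_derive1_comp. Qed.

Lemma is_derive1_sin f x a : is_derive x 1 f a ->
  is_derive x 1 (fun z => sin (f z)) (cos (f x) * a).
Proof. by move=> fa; exact: is_derive1_comp. Qed.

Lemma is_derive1_cos f x a : is_derive x 1 f a ->
  is_derive x 1 (fun z => cos (f z)) (- sin (f x) * a).
Proof. by move=> fa; exact: is_derive1_comp. Qed.

Lemma is_derive1_compf f g x a b : is_derive (g x) 1 f a ->
  is_derive x 1 g b -> is_derive x 1 (fun z => f (g z)) (a * b).
Proof. by move=> fa gb; exact: is_derive1_comp. Qed.

Lemma is_derive1_powRf f r x a : 0 < f x -> is_derive x 1 f a ->
  is_derive x 1 (fun z => f z `^ r) (r * f x `^ (r - 1) * a).
Proof.
move=> fx0 fa.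
exact: (@is_derive1_compf (@powR R ^~ r) f x _ _ (is_derive1_powR r fx0) fa).
Qed.

Lemma is_derive1_derive1 f x a : is_derive x 1 f a -> derive1 f x = a.
Proof. by move=> fa; rewrite derive1E derive_val. Qed.

Lemma is_derive1_continuous f x a : is_derive x 1 f a -> {for x, continuous f}.
Proof.
by case=> df _; apply: differentiable_continuous; exact/derivable1_diffP.
Qed.

Lemma derivable_is_derive1 f x : derivable f x 1 -> is_derive x 1 f (derive1 f x).
Proof. by move=> df; rewrite derive1E; exact: derivableP. Qed.

End calculus.

Section integration.
Context {R : realType}.
Local Notation mu := (@lebesgue_measure R).
Local Notation integr f := (mu.-integrable setT (EFin \o f)).
Implicit Types (f g : R -> R).

Lemma integrable_dominated f g : measurable_fun setT f -> integr g ->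
  (forall x, `|f x| <= g x) -> integr f.
Proof.
move=> mf ig fg; apply: (le_integrable _ _ _ ig) => //.
  exact/measurable_EFinP.
by move=> x _ /=; rewrite lee_fin (le_trans (fg x))// ler_norm.
Qed.

Lemma le_normr_Rintegral_dominated f g : measurable_fun setT f -> integr g ->
  (forall x, `|f x| <= g x) -> `|\int[mu]_x f x| <= \int[mu]_x g x.
Proof.
move=> mf ig fg; have iF := integrable_dominated mf ig fg.
apply: (le_trans (le_normr_Rintegral _ _)) => //.
apply: le_Rintegral => //.
exact: (integrable_abse iF).
Qed.

Lemma integr_measurable f : integr f -> measurable_fun setT f.
Proof. by move=> /integrableP[/measurable_EFinP]. Qed.

Lemma integrM_bounded f g M : integr f -> measurable_fun setT g ->
  (forall x, `|g x| <= M) -> integr (fun x => f x * g x).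
Proof.
move=> iF mg gM; have M0 : 0 <= M by apply: le_trans (gM 0).
apply: (@integrable_dominated _ (fun x => M * `|f x|)).
- by apply: measurable_funM => //; exact: integr_measurable.
- exact: (integrableZl measurableT M (integrable_abse iF)).
- by move=> x; rewrite normrM mulrC ler_wpM2r.
Qed.

Lemma integr_itv f (i : interval R) : integr f ->
  mu.-integrable [set` i] (EFin \o f).
Proof. by move=> iF; apply: (integrableS _ _ _ iF). Qed.

Lemma integrD f g : integr f -> integr g -> integr (fun x => f x + g x).
Proof. by move=> iF ig; exact: (integrableD measurableT iF ig). Qed.

Lemma integrZ c f : integr f -> integr (fun x => c * f x).
Proof. by move=> iF; exact: (integrableZl measurableT c iF). Qed.

Lemma integrN f : integr f -> integr (fun x => - f x).
Proof. by move=> iF; exact: (integrableN iF). Qed.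

Lemma integrB f g : integr f -> integr g -> integr (fun x => f x - g x).
Proof. by move=> iF ig; exact: integrD (integrN ig). Qed.

Lemma integr_norm f : integr f -> integr (fun x => `|f x|).
Proof. by move=> iF; exact: (integrable_abse iF). Qed.

End integration.

(** * Gaussians and their Fourier transforms *)

Section gaussian.
Context {R : realType}.
Local Notation mu := (@lebesgue_measure R).
Local Notation integr f := (mu.-integrable setT (EFin \o f)).
Implicit Types (f g F : R -> R) (c x y z : R).

Definition gauss c x : R := expR (- (c * x ^+ 2)).

Lemma gauss_ge0 c x : 0 <= gauss c x. Proof. exact: expR_ge0. Qed.

Lemma gauss_le1 c x : 0 <= c -> gauss c x <= 1.
Proof. by move=> c0; rewrite -expR0 ler_expR oppr_le0 mulr_ge0// sqr_ge0. Qed.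

Lemma is_derive1_gauss c x : is_derive x 1 (gauss c) (- (2 * c * x) * gauss c x).
Proof.
apply: (is_derive_eq (is_derive1_expR (is_derive1N (is_derive1Z c
  (is_derive1X 2 (is_derive1_id x)))))).
rewrite /gauss /= expr1. ring.
Qed.

Lemma continuous_gauss c : continuous (gauss c).
Proof. by move=> x; exact: is_derive1_continuous (is_derive1_gauss c x). Qed.

Lemma gaussD c1 c2 x : gauss (c1 + c2) x = gauss c1 x * gauss c2 x.
Proof. by rewrite /gauss -expRD; congr expR; ring. Qed.

Lemma gauss_half c x : gauss c x = gauss (c / 2) x * gauss (c / 2) x.
Proof. by rewrite -gaussD -splitr. Qed.

Lemma integral_gauss_center c m : 0 < c ->
  integr (fun x => gauss c (x - m)) /\
  \int[mu]_x gauss c (x - m) = Num.sqrt (pi / c).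
Proof.
move=> c0; set s := Num.sqrt (2 * c)^-1.
have s0 : 0 < s by rewrite sqrtr_gt0 invr_gt0 mulr_gt0.
have s2 : s ^+ 2 = (2 * c)^-1 by rewrite sqr_sqrtr// invr_ge0 mulr_ge0 ?ltW.
have E x : gauss c (x - m) = Num.sqrt (pi / c) * normal_pdf m s x.
  rewrite normal_pdfE ?gt_eqF// /normal_peak s2.
  have -> : ((2 * c)^-1 * pi *+ 2) = pi / c :> R by field; rewrite gt_eqF.
  rewrite mulrA divff ?mul1r; last by rewrite gt_eqF// sqrtr_gt0 divr_gt0 ?pi_gt0.
  by rewrite /normal_fun s2 /gauss; congr expR; field; rewrite gt_eqF.
have i := integrable_normal_pdf m s.
have -> : (fun x => gauss c (x - m)) =
          (fun x => Num.sqrt (pi / c) * normal_pdf m s x) by apply/funext.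
split; first exact: integrZ.
rewrite RintegralZl// /Rintegral integral_normal_pdf/= mulr1//.
Qed.

Lemma integr_gauss c : 0 < c -> integr (gauss c).
Proof.
move=> c0; have [+ _] := integral_gauss_center 0 c0.
by under eq_fun do rewrite subr0.
Qed.

(** One term of the exponential series. *)
Lemma pow_le_expR n x : 0 <= x -> x ^+ n <= n`!%:R * expR x.
Proof.
move=> x0; rewrite -ler_pdivrMl ?ltr0n ?fact_gt0// mulrC.
apply: le_trans (_ : exp_coeff x n <= _); first by rewrite /exp_coeff/=.
have nd : nondecreasing_seq (series (exp_coeff x)).
  by apply: nondecreasing_series => i _ _; rewrite exp_coeff_ge0.
have := nondecreasing_cvgn_le nd (is_cvg_series_exp_coeff x) n.+1.
apply: le_trans; rewrite /series/= big_nat_recr//= lerDr sumr_ge0// => i _.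
by rewrite exp_coeff_ge0.
Qed.

(** [expR `|x|] absorbs the power, and completing the square bounds
    [`|x| - c * x ^+ 2] by [(4 * c)^-1]. *)
Lemma pow_gauss_bounded n c : 0 < c ->
  exists2 C : R, 0 <= C & forall x, `|x| ^+ n * gauss c x <= C.
Proof.
move=> c0; exists (n`!%:R * expR (4 * c)^-1); first by rewrite mulr_ge0 ?expR_ge0.
move=> x; apply: (@le_trans _ _ (n`!%:R * expR `|x| * gauss c x)).
  by rewrite ler_wpM2r ?gauss_ge0 ?pow_le_expR.
rewrite -mulrA ler_wpM2l// /gauss -expRD ler_expR -real_normK ?num_real//.
have -> : `|x| - c * `|x| ^+ 2 = (4 * c)^-1 - c * (`|x| - (2 * c)^-1) ^+ 2.
  by field; rewrite gt_eqF.
by rewrite gerBl mulr_ge0 ?sqr_ge0// ltW.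
Qed.

(** Half of the Gaussian bounds the power, the other half is integrable. *)
Lemma integr_pow_gauss n c : 0 < c -> integr (fun x => x ^+ n * gauss c x).
Proof.
move=> c0; have c20 : 0 < c / 2 by rewrite divr_gt0.
have [C C0 hC] := pow_gauss_bounded n c20.
apply: (@integrable_dominated _ _ (fun x => C * gauss (c / 2) x)).
- apply: measurable_funM.
    exact: exprn_measurable.
  exact: (continuous_measurable_fun (@continuous_gauss c)).
- exact/integrZ/integr_gauss.
- move=> x; rewrite gauss_half mulrA normrM normrM normrX.
  by rewrite !(ger0_norm (gauss_ge0 _ _)) ler_wpM2r ?gauss_ge0.
Qed.

(** The fundamental theorem on [-n, n], and dominated convergence in n. *)
Lemma Rintegral_derive_eq0 F f : (forall x, is_derive x 1 F (f x)) ->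
  continuous f -> integr f ->
  F x @[x --> +oo] --> 0 -> F x @[x --> -oo] --> 0 -> \int[mu]_x f x = 0.
Proof.
move=> dF cf iF Fy FNy.
pose D (n : nat) : set R := `[- n.+1%:R, n.+1%:R]%classic.
have mf := integr_measurable iF.
have intD n : \int[mu]_x (f \_ (D n)) x = F n.+1%:R - F (- n.+1%:R).
  rewrite -Rintegral_mkcond /Rintegral (@continuous_FTC2 _ f F) ?EFinN//.
  - by rewrite gtrN.
  - exact: continuous_subspaceT.
  - have cF x : {for x, continuous F} by exact: is_derive1_continuous (dF x).
    split; first by move=> x _; have [] := dF x.
    + exact/cvg_at_right_filter/cF.
    + exact/cvg_at_left_filter/cF.
  - by move=> x _; rewrite (is_derive1_derive1 (dF x)).
have lim1 : \int[mu]_x (f \_ (D n)) x @[n --> \oo] --> \int[mu]_x f x.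
  apply: fine_cvg; rewrite /Rintegral fineK; last exact: integrable_fin_num.
  apply: (@dominated_cvg _ _ _ mu _ _ (fun n x => ((f \_ (D n)) x)%:E) _
    (fun x => `|f x|%:E)) => //.
  - move=> n; apply/measurable_EFinP.
    have /(measurable_restrictT f)[+ _] : measurable (D n) by exact: measurable_itv.
    by apply; exact: (measurable_funTS mf).
  - move=> x _; apply: cvg_EFin; first exact: nearW.
    apply: cvg_near_cst.
    near=> n; rewrite /= patchE mem_set//= /D/= in_itv/= -ler_norml.
    rewrite (@le_trans _ _ n%:R) ?ler_nat//.
    by near: n; exact: nbhs_infty_ger.
  - exact: integr_norm.
  - move=> n x _; rewrite lee_fin patchE; case: ifP => //.
    by rewrite normr0.
have lim2 : \int[mu]_x (f \_ (D n)) x @[n --> \oo] --> (0 : R).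
  under eq_fun do rewrite intD.
  have ny : n.+1%:R @[n --> \oo] --> (+oo : set_system R).
    by have := @cvgr_idn R; rewrite -(cvg_shiftS (fun n => n%:R : R)).
  have c1 := (cvg_pinftyP _ _).1 Fy _ ny.
  have c2 : F (- n.+1%:R) @[n --> \oo] --> (0 : R).
    by apply: ((cvg_ninftyP _ _).1 FNy); apply/cvgNrNy.
  by have h := cvgB c1 c2; rewrite subrr in h; exact: h.
exact: cvg_unique lim1 lim2.
Unshelve. all: end_near. Qed.
End gaussian.

Section gaussian_transform.
Context {R : realType}.
Local Notation mu := (@lebesgue_measure R).
Local Notation integr f := (mu.-integrable setT (EFin \o f)).
Implicit Types (f g F : R -> R) (c x y z : R).

Lemma is_derive_under_integral (f df : R -> R -> R) (G : R -> R) :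
  (forall z, integr (f z)) ->
  (forall z x, is_derive z 1 (f ^~ x) (df z x)) ->
  integr G -> (forall z x, `|df z x| <= G x) ->
  forall z, is_derive z 1 (fun z => \int[mu]_x f z x) (\int[mu]_x df z x).
Proof.
move=> fi dff iG dfG z.
have E y x : partial1of2 f y x = df y x by exact: is_derive1_derive1 (dff y x).
have h1 y x : derivable (f ^~ x) y 1 by have [] := dff y x.
have h2 x : 0 <= G x by exact: le_trans (dfG 0 x).
have h3 y x : `|partial1of2 f y x| <= G x by rewrite E.
have zI : `]z - 1, z + 1[%classic z by rewrite /= in_itv/= gtrBl ltrDl ltr01.
have -> : \int[mu]_x df z x = derive1 (fun z => \int[mu]_x f z x) z.
  rewrite (@differentiation_under_integral _ _ _ mu f setT _ z _ _ zI _ _ G)//.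
  by apply: eq_Rintegral => x _; rewrite E.
apply: derivable_is_derive1.
exact: (@derivable_under_integral _ _ _ mu f setT _ z _ _ zI _ _ G).
Qed.

Lemma cvg0_pinfty_ninfty f C : (forall x, `|x| * `|f x| <= C) ->
  f x @[x --> +oo] --> 0 /\ f x @[x --> -oo] --> 0.
Proof.
move=> fC; have C0 : 0 <= C by apply: le_trans (fC 0); rewrite mulr_ge0.
split; apply/cvgr0Pnorm_lt => e e0; near=> x.
  have x0 : 0 < x by near: x; exact: nbhs_pinfty_gt.
  rewrite -(ltr_pM2l x0) -{1}(gtr0_norm x0) (le_lt_trans (fC x))//.
  rewrite -ltr_pdivrMr//; near: x; apply: nbhs_pinfty_gt; exact: num_real.
have x0 : x < 0 by near: x; exact: nbhs_ninfty_lt.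
have Nx0 : 0 < - x by rewrite oppr_gt0.
rewrite -(ltr_pM2l Nx0) -{1}(ltr0_norm x0) (le_lt_trans (fC x))//.
rewrite -ltr_pdivrMr// ltrNr; near: x; apply: nbhs_ninfty_lt; exact: num_real.
Unshelve. all: end_near. Qed.

Lemma continuous_mul_lin f z : continuous f -> continuous (fun x => f (x * z)).
Proof.
move=> cf x; apply: (@continuous_comp _ _ _ (fun x => x * z) f); last exact: cf.
exact: mulrr_continuous.
Qed.

Lemma measurable_cos_lin z : measurable_fun setT (fun x : R => cos (x * z)).
Proof. exact: (continuous_measurable_fun (continuous_mul_lin (@continuous_cos R))). Qed.

Lemma measurable_sin_lin z : measurable_fun setT (fun x : R => sin (x * z)).
Proof. exact: (continuous_measurable_fun (continuous_mul_lin (@continuous_sin R))). Qed.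

(** The transform K satisfies K' = - z / (2 c) K: differentiate under the
    integral, then integrate by parts, that is, integrate the derivative of
    [gauss c x * sin (x * z)].  Hence K(z) exp(z^2 / (4 c)) is constant, and its
    value at 0 is the Gaussian integral. *)
Lemma gauss_transform c z : 0 < c ->
  \int[mu]_x (gauss c x * cos (x * z)) =
  Num.sqrt (pi / c) * gauss (4 * c)^-1 z.
Proof.
move=> c0.
pose K z := \int[mu]_x (gauss c x * cos (x * z)).
pose S z := \int[mu]_x (x ^+ 1 * gauss c x * sin (x * z)).
have iC y : integr (fun x => gauss c x * cos (x * y)).
  apply: (@integrM_bounded _ _ _ 1 (integr_gauss c0) (@measurable_cos_lin y)).
  by move=> x; rewrite ler_norml cos_geN1 cos_le1.
have iS y : integr (fun x => x ^+ 1 * gauss c x * sin (x * y)).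
  apply: (@integrM_bounded _ _ _ 1 (integr_pow_gauss 1 c0) (@measurable_sin_lin y)).
  by move=> x; rewrite ler_norml sin_geN1 sin_le1.
have dK y : is_derive y 1 K (- S y).
  have -> : - S y = \int[mu]_x (- (x ^+ 1 * gauss c x * sin (x * y))).
    under eq_Rintegral do rewrite -mulN1r.
    by rewrite RintegralZl// mulN1r.
  apply: (@is_derive_under_integral (fun z x => gauss c x * cos (x * z))
    (fun z x => - (x ^+ 1 * gauss c x * sin (x * z)))
    (fun x => `|x ^+ 1 * gauss c x|)) => //.
  - move=> w x; apply: (is_derive_eq (is_derive1Z (gauss c x)
      (is_derive1_cos (is_derive1_lin x w)))).
    by rewrite expr1; ring.
  - exact/integr_norm/integr_pow_gauss.
  - move=> w x; rewrite normrN normrM ler_piMr//.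
    by rewrite ler_norml sin_geN1 sin_le1.
have KS y : 2 * c * S y = y * K y.
  have [g0 Ng0] : (fun x => gauss c x * sin (x * y)) x @[x --> +oo] --> 0 /\
      (fun x => gauss c x * sin (x * y)) x @[x --> -oo] --> 0.
    have [C _ hC] := pow_gauss_bounded 1 c0.
    apply: (@cvg0_pinfty_ninfty _ C) => x; apply: le_trans (hC x).
    rewrite expr1 normrM (ger0_norm (gauss_ge0 _ _)) ler_wpM2l//.
    by rewrite ler_piMr ?gauss_ge0// ler_norml sin_geN1 sin_le1.
  have dg x : is_derive x 1 (fun x => gauss c x * sin (x * y))
      (y * (gauss c x * cos (x * y)) -
       2 * c * (x ^+ 1 * gauss c x * sin (x * y))).
    apply: (is_derive_eq (is_derive1M (is_derive1_gauss c x)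
      (is_derive1_sin (is_derive1M (is_derive1_id x) (is_derive1_cst y x))))).
    by rewrite expr1; ring.
  have cg : continuous (fun x => y * (gauss c x * cos (x * y)) -
       2 * c * (x ^+ 1 * gauss c x * sin (x * y))).
    move=> x; apply: cvgB; apply: cvgM; try exact: cvg_cst; apply: cvgM.
    - exact: continuous_gauss.
    - exact: (continuous_mul_lin (@continuous_cos R)).
    - by apply: cvgM; [exact: exprn_continuous|exact: continuous_gauss].
    - exact: (continuous_mul_lin (@continuous_sin R)).
  have ig := integrB (integrZ y (iC y)) (integrZ (2 * c) (iS y)).
  have := Rintegral_derive_eq0 dg cg ig g0 Ng0.
  rewrite RintegralB//; try exact: integrZ.
  by rewrite !RintegralZl// => /eqP; rewrite subr_eq0 => /eqP.
have K0 : K 0 = Num.sqrt (pi / c).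
  have [_ <-] := integral_gauss_center 0 c0.
  by apply: eq_Rintegral => x _; rewrite mulr0 cos0 mulr1 subr0.
have dH y : is_derive y 1 (fun y => K y * gauss (- (4 * c)^-1) y) 0.
  apply: (is_derive_eq (is_derive1M (dK y) (is_derive1_gauss _ y))).
  have -> : S y = (2 * c)^-1 * (y * K y).
    by rewrite -KS mulKf// gt_eqF// mulr_gt0.
  by field; rewrite gt_eqF.
have /= := @is_derive_0_is_cst _ _ z 0 dH.
rewrite K0 {2}/gauss expr0n/= mulr0 oppr0 expR0 mulr1 => <-.
by rewrite -mulrA -gaussD addNr /gauss mul0r oppr0 expR0 mulr1.
Qed.

End gaussian_transform.

(** * Fourier inversion *)

Section schwartz_gaussian.
Context {R : realType}.
Implicit Types (c x y z : R) (p q : {poly R}).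

(** A class of Schwartz functions closed under derivation that contains the
    Gaussians modulated by [cos (x * y)] and [sin (x * y)]; these are the only
    test functions that Fourier inversion uses. *)
Definition gauss_trig c y p q x : R :=
  gauss c x * (p.[x] * cos (x * y) + q.[x] * sin (x * y)).

Lemma is_derive1_gauss_trig c y p q x :
  is_derive x 1 (gauss_trig c y p q)
    (gauss_trig c y (deriv p + y *: q - (2 * c) *: (p * 'X))
                    (deriv q - y *: p - (2 * c) *: (q * 'X)) x).
Proof.
have dl : is_derive x 1 (fun z => z * y) (1 * y + x * 0).
  exact: is_derive1M (is_derive1_id x) (is_derive1_cst y x).
have dp (r : {poly R}) : is_derive x 1 (fun z => r.[z]) (deriv r).[x].
  exact: is_derive_poly.
apply: (is_derive_eq (is_derive1M (is_derive1_gauss c x)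
  (is_derive1D (is_derive1M (dp p) (is_derive1_cos dl))
               (is_derive1M (dp q) (is_derive1_sin dl))))).
rewrite /gauss_trig !(hornerD, hornerN, hornerZ, hornerMX).
by ring.
Qed.

Lemma derive1n_gauss_trig c y n p q :
  exists p' q', derive1n n (gauss_trig c y p q) = gauss_trig c y p' q'.
Proof.
elim: n => [|n [p' [q' IH]]]; first by exists p, q.
rewrite derive1nS IH; eexists; eexists; apply/funext => x.
exact: is_derive1_derive1 (is_derive1_gauss_trig _ _ _ _ _).
Qed.

Lemma poly_gauss_bounded c p : 0 < c ->
  forall m, exists2 C : R, 0 <= C &
    forall x, `|x| ^+ m * `|p.[x]| * gauss c x <= C.
Proof.
move=> c0; elim/poly_ind: p => [|p a IH] m.
  by exists 0 => // x; rewrite horner0 normr0 mulr0 mul0r.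
have [C C0 hC] := IH m.+1; have [C' C'0 hC'] := pow_gauss_bounded m c0.
exists (C + `|a| * C'); first by rewrite addr_ge0// mulr_ge0.
move=> x; rewrite hornerMXaddC.
apply: (@le_trans _ _ (`|x| ^+ m * (`|p.[x]| * `|x| + `|a|) * gauss c x)).
  rewrite ler_wpM2r ?gauss_ge0// ler_wpM2l ?exprn_ge0//.
  by rewrite -normrM ler_normD.
rewrite mulrDr mulrDl lerD//.
  by rewrite [`|p.[x]| * _]mulrC mulrA -exprSr.
by rewrite [_ * `|a|]mulrC -mulrA ler_wpM2l.
Qed.

Lemma schwartz_gauss_trig c y p q : 0 < c -> schwartz (gauss_trig c y p q).
Proof.
move=> c0; split=> [n x|m n].
  have [p' [q' ->]] := derive1n_gauss_trig c y n p q.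
  by have [] := is_derive1_gauss_trig c y p' q' x.
have [p' [q' ->]] := derive1n_gauss_trig c y n p q.
have [C _ hC] := poly_gauss_bounded p' c0 m.
have [D _ hD] := poly_gauss_bounded q' c0 m.
exists (C + D) => x.
rewrite normrM normrX /gauss_trig normrM (ger0_norm (gauss_ge0 _ _)).
apply: (@le_trans _ _
    (`|x| ^+ m * (gauss c x * (`|p'.[x]| + `|q'.[x]|)))).
  rewrite ler_wpM2l ?exprn_ge0// ler_wpM2l ?gauss_ge0//.
  rewrite (le_trans (ler_normD _ _))// !normrM lerD// ler_piMr//.
    by rewrite ler_norml cos_geN1 cos_le1.
  by rewrite ler_norml sin_geN1 sin_le1.
rewrite [gauss c x * _]mulrC mulrA mulrDr mulrDl lerD//.
Qed.

End schwartz_gaussian.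

Section fourier_inversion.
Context {R : realType}.
Local Notation mu := (@lebesgue_measure R).
Local Notation integr f := (mu.-integrable setT (EFin \o f)).
Implicit Types (f : R -> R) (c d x y z : R) (h : (R -> R) * (R -> R)).

Lemma abs_le_1sqr x : `|x| <= 1 + x ^+ 2.
Proof.
rewrite -real_normK ?num_real//; set t := `|x|.
by have := sqr_ge0 (t - 1); nra.
Qed.

Lemma expRN_leV x : 0 < x -> expR (- x) <= x^-1.
Proof.
move=> x0; rewrite expRN lef_pV2 ?posrE ?expR_gt0//.
by apply: le_trans (expR_ge1Dx x); rewrite lerDr.
Qed.

Lemma measurable_gauss_center d y : measurable_fun setT (fun x => gauss d (x - y)).
Proof.
apply: continuous_measurable_fun => x.
apply: (@continuous_comp _ _ _ (fun x => x - y) (gauss d)).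
  by apply: cvgB; [exact: cvg_id|exact: cvg_cst].
exact: continuous_gauss.
Qed.

Lemma L2_measurable f : f \in Lfun mu 2%:E -> measurable_fun setT f.
Proof. by rewrite inE => /andP[/[!inE]]. Qed.

(** The Gaussian is at most 1, so [`|f| <= 1 + f ^+ 2] suffices. *)
Lemma integr_L2_gauss f d y : f \in Lfun mu 2%:E -> 0 < d ->
  integr (fun x => f x * gauss d (x - y)).
Proof.
move=> f2 d0; have if2 := Lfun2_integrable_sqr f2.
have [ig _] := integral_gauss_center y d0.
apply: integrable_dominated (integrD ig if2) _.
  by apply: measurable_funM; [exact: L2_measurable|exact: measurable_gauss_center].
move=> x; rewrite normrM (ger0_norm (gauss_ge0 _ _)).
apply: (@le_trans _ _ ((1 + f x ^+ 2) * gauss d (x - y))).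
  by rewrite ler_wpM2r ?gauss_ge0 ?abs_le_1sqr.
by rewrite mulrDl mul1r lerD// ler_piMr ?sqr_ge0// gauss_le1// ltW.
Qed.

(** The real part of the inverse transform, up to the factor [2 * pi].  When [h]
    is the transform of a real function, the imaginary part vanishes. *)
Definition inv_fourier h x : R :=
  \int[mu]_xi (h.1 xi * cos (xi * x) - h.2 xi * sin (xi * x)).

(** Test the distributional transform against [cos (xi * y)] and [sin (xi * y)]
    times a Gaussian.  By the product formulas the transforms of these tests are
    the half sum and the half difference of Gaussians centred at [y] and [- y],
    and in the combination below the one at [- y] cancels. *)
Lemma fourier_gauss f h c y : fourier_of f h -> integr h.1 -> integr h.2 ->
  0 < c ->
  \int[mu]_xi ((h.1 xi * cos (xi * y) - h.2 xi * sin (xi * y)) * gauss c xi) =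
  Num.sqrt (pi / c) * \int[mu]_x (f x * gauss (4 * c)^-1 (x - y)).
Proof.
move=> [f2 _ _ fh] i1 i2 c0.
set s := Num.sqrt _; set d := (4 * c)^-1.
have d0 : 0 < d by rewrite invr_gt0 mulr_gt0.
have ic z : integr (fun xi => gauss c xi * cos (xi * z)).
  apply: (@integrM_bounded _ _ _ 1 (integr_gauss c0)).
    exact: measurable_cos_lin.
  by move=> xi; rewrite ler_norml cos_geN1 cos_le1.
have tc x : cos_transform (gauss_trig c y 1 0) x =
    s / 2 * gauss d (x - y) + s / 2 * gauss d (x + y).
  rewrite /cos_transform.
  transitivity (\int[mu]_xi (2^-1 * (gauss c xi * cos (xi * (x - y))) +
                             2^-1 * (gauss c xi * cos (xi * (x + y))))).
    apply: eq_Rintegral => xi _; rewrite /gauss_trig horner0 hornerC mul1r mul0r.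
    have -> : xi * (x - y) = xi * x - xi * y by ring.
    have -> : xi * (x + y) = xi * x + xi * y by ring.
    by rewrite cosB cosD; field.
  rewrite RintegralD//; try exact: integrZ.
  rewrite !RintegralZl//.
  by rewrite !gauss_transform// -/s -/d; ring.
have ts x : sin_transform (gauss_trig c y 0 1) x =
    s / 2 * gauss d (x - y) - s / 2 * gauss d (x + y).
  rewrite /sin_transform.
  transitivity (\int[mu]_xi (2^-1 * (gauss c xi * cos (xi * (x - y))) -
                             2^-1 * (gauss c xi * cos (xi * (x + y))))).
    apply: eq_Rintegral => xi _; rewrite /gauss_trig horner0 hornerC mul1r mul0r.
    have -> : xi * (x - y) = xi * x - xi * y by ring.
    have -> : xi * (x + y) = xi * x + xi * y by ring.
    by rewrite cosB cosD; field.
  rewrite RintegralB//; try exact: integrZ.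
  rewrite !RintegralZl//.
  by rewrite !gauss_transform// -/s -/d; ring.
have [hc _] := fh _ (schwartz_gauss_trig y 1 0 c0).
have [_ hs] := fh _ (schwartz_gauss_trig y 0 1 c0).
have ib (g t : R -> R) : integr g -> measurable_fun setT t ->
    (forall x, `|t x| <= 1) -> integr (fun xi => g xi * (t xi * gauss c xi)).
  move=> ig mt t1; apply: (@integrM_bounded _ _ _ 1 ig).
    apply: measurable_funM => //.
    exact: continuous_measurable_fun (@continuous_gauss _ c).
  move=> x; rewrite normrM mulr_ile1// (ger0_norm (gauss_ge0 _ _)).
  by rewrite gauss_le1// ltW.
transitivity (\int[mu]_xi (h.1 xi * gauss_trig c y 1 0 xi) -
              \int[mu]_xi (h.2 xi * gauss_trig c y 0 1 xi)).
  have E1 : (fun xi => h.1 xi * gauss_trig c y 1 0 xi) =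
            (fun xi => h.1 xi * (cos (xi * y) * gauss c xi)).
    by apply/funext => xi; rewrite /gauss_trig horner0 hornerC; ring.
  have E2 : (fun xi => h.2 xi * gauss_trig c y 0 1 xi) =
            (fun xi => h.2 xi * (sin (xi * y) * gauss c xi)).
    by apply/funext => xi; rewrite /gauss_trig horner0 hornerC; ring.
  rewrite E1 E2 -RintegralB//.
  - by apply: eq_Rintegral => xi _; ring.
  - apply: ib => //; first exact: measurable_cos_lin.
    by move=> xi; rewrite ler_norml cos_geN1 cos_le1.
  - apply: ib => //; first exact: measurable_sin_lin.
    by move=> xi; rewrite ler_norml sin_geN1 sin_le1.
rewrite hc hs opprK.
under eq_Rintegral do rewrite tc mulrDr mulrCA [f _ * (s / 2 * _)]mulrCA.
under [X in _ + X]eq_Rintegral do rewrite ts mulrBr mulrCA [f _ * (s / 2 * _)]mulrCA.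
have j1 := integrZ (s / 2) (integr_L2_gauss y f2 d0).
have j2 := integrZ (s / 2) (integr_L2_gauss (- y) f2 d0).
rewrite opprK in j2.
rewrite -RintegralD//; [|exact: integrD|exact: integrB].
rewrite -RintegralZl//; last exact: integr_L2_gauss.
by apply: eq_Rintegral => x _; field.
Qed.

(** [f] may be unbounded, but [`|f x - f y| <= 1 + `|f y| + f x ^+ 2].  Away from
    [y] the kernel of width [d] is at most [2 / (del ^+ 2 * sqrt d)] times the
    fixed kernel [gauss 2^-1], against which that bound is integrable. *)
Lemma gauss_approx_identity f y : continuous f -> f \in Lfun mu 2%:E ->
  Num.sqrt (n.+1%:R / pi) * \int[mu]_x (f x * gauss n.+1%:R (x - y))
    @[n --> \oo] --> f y.
Proof.
move=> cf f2; have if2 := Lfun2_integrable_sqr f2.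
pose K := \int[mu]_x ((1 + `|f y| + f x ^+ 2) * gauss 2^-1 (x - y)).
have p2 : 0 < 2^-1 :> R by rewrite invr_gt0.
have iK : integr (fun x => (1 + `|f y| + f x ^+ 2) * gauss 2^-1 (x - y)).
  have [ig _] := integral_gauss_center y p2.
  apply: integrable_dominated (integrD (integrZ (1 + `|f y|) ig) if2) _.
    apply: measurable_funM; last exact: measurable_gauss_center.
    apply: measurable_funD => //; apply: measurable_funX; exact: L2_measurable.
  move=> x; rewrite ger0_norm; last first.
    by rewrite mulr_ge0 ?gauss_ge0// addr_ge0 ?sqr_ge0// addr_ge0.
  by rewrite mulrDl lerD// ler_piMr ?sqr_ge0// gauss_le1// ltW.
have K0 : 0 <= K.
  apply: Rintegral_ge0 => x _.
  by rewrite mulr_ge0 ?gauss_ge0// addr_ge0 ?sqr_ge0// addr_ge0.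
apply/cvgrPdist_le => e e0.
have e20 : 0 < e / 2 by rewrite divr_gt0.
have /cvgrPdist_lt/(_ _ e20) := cf y.
move=> -[del /= del0 hdel].
near=> n; set d : R := n.+1%:R.
have d1 : 1 <= d by rewrite ler1n.
have d0 : 0 < d by rewrite ltr0n.
have [ig Eg] := integral_gauss_center y d0.
set w := Num.sqrt (d / pi).
have w0 : 0 <= w by rewrite sqrtr_ge0.
have w1 : w * Num.sqrt (pi / d) = 1.
  rewrite -sqrtrM ?divr_ge0 ?pi_ge0// mulrA divfK ?gt_eqF ?pi_gt0//.
  by rewrite divff ?sqrtr1// gt_eqF.
have ifg := integr_L2_gauss y f2 d0.
have -> : f y - w * \int[mu]_x (f x * gauss d (x - y)) =
          \int[mu]_x (w * ((f y - f x) * gauss d (x - y))).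
  under [RHS]eq_Rintegral do rewrite mulrBl.
  rewrite RintegralZl// ?RintegralB//; try exact: integrZ.
    by rewrite RintegralZl// Eg mulrBr mulrCA w1 mulr1.
  exact: integrB (integrZ _ ig) ifg.
(* expR (- z) <= z^-1 at z = d / 2 * del ^+ 2, times the peak sqrt d *)
set k : R := 2 / (del ^+ 2 * Num.sqrt d).
apply: (@le_trans _ _ (\int[mu]_x (e / 2 * (w * gauss d (x - y)) +
    k * ((1 + `|f y| + f x ^+ 2) * gauss 2^-1 (x - y))))).
  apply: le_normr_Rintegral_dominated.
  - apply: measurable_funM => //; apply: measurable_funM.
      by apply: measurable_funB => //; exact: L2_measurable.
    exact: measurable_gauss_center.
  - exact: integrD (integrZ _ (integrZ _ ig)) (integrZ _ iK).
  - move=> x; rewrite !normrM (ger0_norm w0) (ger0_norm (gauss_ge0 _ _)).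
    have sd0 : 0 < Num.sqrt d by rewrite sqrtr_gt0.
    have k0 : 0 <= k by rewrite divr_ge0// mulr_ge0 ?sqr_ge0// ltW.
    have [yx|yx] := ltP `|y - x| del.
      have := hdel x yx => /ltW fyx.
      rewrite -[leLHS]addr0 lerD//.
        by rewrite mulrCA ler_wpM2r// mulr_ge0// gauss_ge0.
      by rewrite mulr_ge0// mulr_ge0 ?gauss_ge0// addr_ge0 ?sqr_ge0// addr_ge0.
    rewrite -[leLHS]add0r lerD//.
      by rewrite mulr_ge0// ?mulr_ge0 ?gauss_ge0// ltW.
    have fb : `|f y - f x| <= 1 + `|f y| + f x ^+ 2.
      by have := abs_le_1sqr (f x); have := ler_normB (f y) (f x); lra.
    have gb : w * gauss d (x - y) <= k * gauss 2^-1 (x - y).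
      rewrite (gauss_half d) mulrA.
      apply: ler_pM; rewrite ?mulr_ge0 ?gauss_ge0//.
        apply: (@le_trans _ _ (Num.sqrt d * (2 / (d * del ^+ 2)))).
          apply: ler_pM; rewrite ?gauss_ge0 ?sqrtr_ge0//.
            rewrite ler_wsqrtr// ler_pdivrMr ?pi_gt0// ler_peMr ?ltW//.
            by rewrite (lt_le_trans _ (pi_ge2 R))// ltr1n.
          apply: (@le_trans _ _ (d / 2 * (x - y) ^+ 2)^-1).
            apply: expRN_leV.
            rewrite mulr_gt0 ?divr_gt0// exprn_even_gt0//=.
            by rewrite -normr_gt0 distrC (lt_le_trans del0).
          rewrite -[leRHS]invrK lef_pV2 ?posrE ?invr_gt0; last 2 first.
            rewrite mulr_gt0 ?divr_gt0// exprn_even_gt0//=.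
            by rewrite -normr_gt0 distrC (lt_le_trans del0).
            by rewrite divr_gt0// mulr_gt0// exprn_gt0.
          have h : del ^+ 2 <= (x - y) ^+ 2.
            rewrite -[leRHS]real_normK ?num_real// distrC.
            by rewrite ler_pXn2r// ?nnegrE// ltW.
          by rewrite invf_div; have := ler_wpM2l (ltW d0) h; lra.
        rewrite /k -{2}(sqr_sqrtr (ltW d0)) le_eqVlt; apply/orP; left; apply/eqP.
        by field; rewrite !gt_eqF.
      rewrite /gauss ler_expR lerN2 ler_wpM2r ?sqr_ge0//.
      by rewrite -{1}[2^-1]mul1r ler_wpM2r.
    rewrite mulrCA [leRHS]mulrCA.
    by apply: ler_pM => //; rewrite mulr_ge0// gauss_ge0.
rewrite RintegralD//; last 2 first.
  exact: (integrZ _ (integrZ _ ig)).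
  exact: (integrZ _ iK).
rewrite !RintegralZl//; last exact: integrZ.
rewrite Eg w1 mulr1 -/K.
suff : k * K <= e / 2 by lra.
have sd0 : 0 < Num.sqrt d by rewrite sqrtr_gt0.
rewrite /k mulrAC ler_pdivrMr ?mulr_gt0 ?exprn_gt0//.
suff : 4 * K / (del ^+ 2 * e) <= Num.sqrt d.
  by rewrite ler_pdivrMr ?mulr_gt0 ?exprn_gt0//; lra.
have A0 : 0 <= 4 * K / (del ^+ 2 * e).
  by rewrite divr_ge0 ?mulr_ge0 ?exprn_ge0// ltW.
rewrite -(ger0_norm A0) -sqrtr_sqr ler_wsqrtr//.
rewrite (@le_trans _ _ n%:R) ?ler_nat//; near: n; exact: nbhs_infty_ger.
Unshelve. all: end_near. Qed.

End fourier_inversion.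

Section fourier_representation.
Context {R : realType}.
Local Notation mu := (@lebesgue_measure R).
Local Notation integr f := (mu.-integrable setT (EFin \o f)).
Implicit Types (f : R -> R) (c d s x y z : R) (h : (R -> R) * (R -> R)).

Lemma integr_inv_fourier h x : integr h.1 -> integr h.2 ->
  integr (fun xi => h.1 xi * cos (xi * x) - h.2 xi * sin (xi * x)).
Proof.
move=> i1 i2; apply: integrB.
  apply: (@integrM_bounded _ _ _ 1 i1 (@measurable_cos_lin _ x)).
  by move=> xi; rewrite ler_norml cos_geN1 cos_le1.
apply: (@integrM_bounded _ _ _ 1 i2 (@measurable_sin_lin _ x)).
by move=> xi; rewrite ler_norml sin_geN1 sin_le1.
Qed.

Lemma normr_cos_sin_le a b x : `|a * cos x - b * sin x| <= `|a| + `|b|.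
Proof.
rewrite (le_trans (ler_normB _ _))// !normrM lerD// ler_piMr//.
  by rewrite ler_norml cos_geN1 cos_le1.
by rewrite ler_norml sin_geN1 sin_le1.
Qed.

Lemma inv_fourier_le h x : integr h.1 -> integr h.2 ->
  `|inv_fourier h x| <= \int[mu]_xi `|h.1 xi| + \int[mu]_xi `|h.2 xi|.
Proof.
move=> i1 i2; rewrite -RintegralD//; try exact: integr_norm.
apply: le_normr_Rintegral_dominated.
- exact: integr_measurable (integr_inv_fourier x i1 i2).
- exact: integrD (integr_norm i1) (integr_norm i2).
- by move=> xi; exact: normr_cos_sin_le.
Qed.

(** Let the Gaussian cut-off in [fourier_gauss] tend to 1: the left-hand side
    converges by dominated convergence, the right-hand side because the
    transforms of the cut-offs form an approximate identity.  The convergence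
    holds at every point because [f] is continuous. *)
Theorem fourier_inversion f h : continuous f -> fourier_of f h ->
  integr h.1 -> integr h.2 -> forall y, 2 * pi * f y = inv_fourier h y.
Proof.
move=> cf fh i1 i2 y.
have f2 : f \in Lfun mu 2%:E by case: fh.
pose c (n : nat) : R := (4 * n.+1%:R)^-1.
have c0 n : 0 < c n by rewrite invr_gt0 mulr_gt0.
have c4 n : (4 * c n)^-1 = n.+1%:R.
  rewrite /c; have : n.+1%:R != 0 :> R by rewrite pnatr_eq0.
  by move: (n.+1%:R) => m m0; field.
pose a n := \int[mu]_xi ((h.1 xi * cos (xi * y) - h.2 xi * sin (xi * y)) *
  gauss (c n) xi).
have aE n : a n = 2 * pi * (Num.sqrt (n.+1%:R / pi) *
    \int[mu]_x (f x * gauss n.+1%:R (x - y))).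
  have m0 : n.+1%:R != 0 :> R by rewrite pnatr_eq0.
  rewrite /a (fourier_gauss y fh i1 i2 (c0 n)) mulrA; congr (_ * _).
    have tp : 0 <= 2 * pi :> R by rewrite mulr_ge0// pi_ge0.
    rewrite -[2 * pi](ger0_norm tp) -sqrtr_sqr -sqrtrM ?sqr_ge0//.
    congr Num.sqrt; rewrite /c; move: (n.+1%:R) m0 => m m0.
    by have := pi_gt0 R; move: (@pi R) => p p0; field; rewrite m0 gt_eqF.
  by rewrite c4.
have lim1 : a n @[n --> \oo] --> 2 * pi * f y.
  under eq_fun do rewrite aE.
  by apply: cvgMr; exact: gauss_approx_identity.
have ih := integr_inv_fourier y i1 i2.
have ia n : integr (fun xi => (h.1 xi * cos (xi * y) - h.2 xi * sin (xi * y)) *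
    gauss (c n) xi).
  apply: (@integrM_bounded _ _ _ 1 ih).
    exact: continuous_measurable_fun (@continuous_gauss _ (c n)).
  by move=> xi; rewrite ger0_norm ?gauss_ge0// gauss_le1// ltW.
have cc0 : c n @[n --> \oo] --> (0 : R).
  have -> : c = (fun n => 4^-1 * harmonic n).
    by apply/funext => n; rewrite /c invfM.
  by rewrite -(mulr0 4^-1); apply: cvgMr; exact: cvg_harmonic.
have lim2 : a n @[n --> \oo] --> inv_fourier h y.
  apply: fine_cvg; rewrite /inv_fourier /Rintegral fineK; last first.
    exact: integrable_fin_num.
  apply: (@dominated_cvg _ _ _ mu _ _ (fun n xi => ((h.1 xi * cos (xi * y) -
     h.2 xi * sin (xi * y)) * gauss (c n) xi)%:E) _
    (fun xi => `|h.1 xi * cos (xi * y) - h.2 xi * sin (xi * y)|%:E)) => //.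
  - by move=> n; apply/measurable_EFinP; exact: integr_measurable (ia n).
  - move=> xi _; apply: cvg_EFin; first exact: nearW.
    rewrite -[X in _ --> X]mulr1; apply: cvgMr.
    have -> : 1 = expR (- (0 * xi ^+ 2)) :> R by rewrite mul0r oppr0 expR0.
    apply: (cvg_comp (fun n => - (c n * xi ^+ 2)) expR); last exact: continuous_expR.
    by apply: cvgN; apply: cvgMl.
  - exact: integr_norm.
  - move=> n xi _; rewrite lee_fin normrM ler_piMr// ger0_norm ?gauss_ge0//.
    by rewrite gauss_le1// ltW.
exact: cvg_unique lim1 lim2.
Qed.

(** Multiplication by [i * xi], which represents the derivative. *)
Definition fourier_dx h : (R -> R) * (R -> R) :=
  (fun xi => - (xi * h.2 xi), fun xi => xi * h.1 xi).

Lemma is_derive1_inv_fourier h x : integr h.1 -> integr h.2 ->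
  integr (fourier_dx h).1 -> integr (fourier_dx h).2 ->
  is_derive x 1 (inv_fourier h) (inv_fourier (fourier_dx h) x).
Proof.
move=> i1 i2 j1 j2.
apply: (@is_derive_under_integral _
  (fun x xi => h.1 xi * cos (xi * x) - h.2 xi * sin (xi * x))
  (fun x xi => (fourier_dx h).1 xi * cos (xi * x) -
               (fourier_dx h).2 xi * sin (xi * x))
  (fun xi => `|(fourier_dx h).1 xi| + `|(fourier_dx h).2 xi|)).
- by move=> z; exact: integr_inv_fourier.
- move=> z xi; apply: (is_derive_eq (is_derive1B
    (is_derive1Z (h.1 xi) (is_derive1_cos (is_derive1_lin xi z)))
    (is_derive1Z (h.2 xi) (is_derive1_sin (is_derive1_lin xi z))))).
  by rewrite /fourier_dx/=; ring.
- exact: integrD (integr_norm j1) (integr_norm j2).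
- by move=> z xi; exact: normr_cos_sin_le.
Qed.

Lemma continuous_inv_fourier h : integr h.1 -> integr h.2 ->
  continuous (inv_fourier h).
Proof.
move=> i1 i2 x.
have xI : x \in (`]x - 1, x + 1[%classic : set R).
  by rewrite inE /= in_itv/= gtrBl ltrDl ltr01.
apply: (@continuity_under_integral _ _ _ mu
  (fun x xi => h.1 xi * cos (xi * x) - h.2 xi * sin (xi * x)) setT _
  (x - 1) (x + 1) _ _ (fun xi => `|h.1 xi| + `|h.2 xi|)) => //.
- by move=> z _; exact: integr_inv_fourier.
- apply: aeW => xi _ z _; apply: is_derive1_continuous (is_derive1B
    (is_derive1Z (h.1 xi) (is_derive1_cos (is_derive1_lin xi z)))
    (is_derive1Z (h.2 xi) (is_derive1_sin (is_derive1_lin xi z)))).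
- exact: integrD (integr_norm i1) (integr_norm i2).
- by move=> z _; apply: aeW => xi _; exact: normr_cos_sin_le.
Qed.

End fourier_representation.

(** * Sobolev embedding *)

Section sobolev_embedding.
Context {R : realType}.
Local Notation mu := (@lebesgue_measure R).
Local Notation integr f := (mu.-integrable setT (EFin \o f)).
Implicit Types (f : R -> R) (r s x y z : R) (h : (R -> R) * (R -> R)).

Lemma continuous_bracket_powR r : continuous (fun x : R => (1 + x ^+ 2) `^ r).
Proof.
move=> x; have x0 : 0 < 1 + x ^+ 2 by rewrite ltr_pwDl ?sqr_ge0.
have d : is_derive x 1 (fun x : R => 1 + x ^+ 2) _ :=
  is_derive1D (is_derive1_cst 1 x) (is_derive1X 2 (is_derive1_id x)).
exact: is_derive1_continuous
  (@is_derive1_powRf _ (fun x => 1 + x ^+ 2) r x _ x0 d).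
Qed.

Lemma measurable_bracket_powR r :
  measurable_fun setT (fun x : R => (1 + x ^+ 2) `^ r).
Proof. exact: continuous_measurable_fun (@continuous_bracket_powR r). Qed.

(** The antiderivative is [(1 + x) `^ (1 - r) / (1 - r)], which tends to 0. *)
Lemma integral_onedx_powR r : 1 < r ->
  (\int[mu]_(x in `[0%R, +oo[) ((1 + x) `^ (- r))%:E < +oo)%E.
Proof.
move=> r1.
have r0 : 1 - r != 0 by rewrite subr_eq0 lt_eqF.
have dF x : 0 <= x -> is_derive x 1 (fun x => (1 - r)^-1 * (1 + x) `^ (1 - r))
    ((1 + x) `^ (- r)).
  move=> x0; have x10 : 0 < 1 + x by rewrite ltr_pwDl.
  have d := is_derive1D (is_derive1_cst 1 x) (is_derive1_id x).
  apply: (is_derive_eq (is_derive1Z (1 - r)^-1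
    (@is_derive1_powRf _ (fun x => 1 + x) (1 - r) x _ x10 d))).
  by rewrite add0r mulr1 mulKf//; congr (_ `^ _); ring.
have cf x : 0 <= x -> {for x, continuous (fun x => (1 + x) `^ (- r))}.
  move=> x0; have x10 : 0 < 1 + x by rewrite ltr_pwDl.
  have d := is_derive1D (is_derive1_cst 1 x) (is_derive1_id x).
  exact: is_derive1_continuous (@is_derive1_powRf _ (fun x => 1 + x) (- r) x _ x10 d).
rewrite (@ge0_continuous_FTC2y _ _ (fun x => (1 - r)^-1 * (1 + x) `^ (1 - r)) 0 0).
- exact: ltry.
- by move=> x _; exact: powR_ge0.
- apply: continuous_in_subspaceT => x; rewrite inE/= in_itv/= andbT; exact: cf.
- rewrite -(mulr0 (1 - r)^-1); apply: cvgMr.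
  apply/cvgr0Pnorm_lt => e e0; near=> x.
  have p0 : 0 < r - 1 by rewrite subr_gt0.
  have xe : e `^ (- (r - 1)^-1) < x.
    by near: x; apply: nbhs_pinfty_gt; exact: num_real.
  have x0 : 0 < x by apply: le_lt_trans xe; exact: powR_ge0.
  rewrite ger0_norm ?powR_ge0// -opprB powRN -[ltRHS]invrK.
  rewrite ltf_pV2 ?posrE ?invr_gt0 ?powR_gt0 ?ltr_pwDl ?(ltW x0)//.
  apply: (@lt_trans _ _ (x `^ (r - 1))).
    have -> : e^-1 = (e `^ (- (r - 1)^-1)) `^ (r - 1).
      by rewrite -powRrM mulNr mulVf ?gt_eqF// powR_inv1// ltW.
    by rewrite gt0_ltr_powR ?nnegrE ?powR_ge0// ltW.
  by rewrite gt0_ltr_powR ?nnegrE ?addr_ge0// ?(ltW x0)// ltrDr.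
- by move=> x /ltW/dF[].
- exact: cvg_at_right_filter (is_derive1_continuous (dF 0 (lexx 0))).
- by move=> x; rewrite in_itv/= andbT => /ltW/dF/is_derive1_derive1.
Unshelve. all: end_near. Qed.

(** By parity and [(1 + x) ^+ 2 <= 2 * (1 + x ^+ 2)]. *)
Lemma integr_bracket_powR r : 2^-1 < r ->
  integr (fun x => (1 + x ^+ 2) `^ (- r)).
Proof.
move=> r2; apply/integrableP; split.
  by apply/measurable_EFinP; exact: (@measurable_bracket_powR (- r)).
under eq_integral do rewrite /= ger0_norm ?powR_ge0//.
rewrite ge0_symfun_integralT; last 3 first.
- by move=> x; exact: powR_ge0.
- exact: continuous_bracket_powR.
- by move=> x; rewrite /= sqrrN.
rewrite lte_mul_pinfty// -set_itvcy.
apply: (@le_lt_trans _ _ (\int[mu]_(x in `[0%R, +oo[)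
    (2 `^ r * (1 + x) `^ (- (2 * r)))%:E)%E).
  apply: ge0_le_integral => //.
  - by move=> x _; rewrite lee_fin powR_ge0.
  - apply/measurable_EFinP; exact: measurable_funTS (@measurable_bracket_powR _).
  - apply/measurable_EFinP/measurable_funM => //.
    apply: (@measurableT_comp _ _ _ _ _ _ (fun x : R => x `^ _)) => //.
    exact: measurable_funD.
  - move=> x; rewrite /= in_itv/= andbT => x0; rewrite lee_fin.
    rewrite !powRN ler_pdivlMr ?powR_gt0 ?ltr_pwDl// mulrC.
    rewrite ler_pdivrMr ?powR_gt0 ?ltr_pwDl ?sqr_ge0//.
    rewrite powRrM powR_mulrn ?addr_ge0// -powRM ?addr_ge0 ?sqr_ge0//.
    rewrite ge0_ler_powR ?nnegrE ?sqr_ge0 ?mulr_ge0 ?addr_ge0 ?sqr_ge0//.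
      by lra.
    by have := sqr_ge0 (1 - x); lra.
under eq_integral do rewrite EFinM.
rewrite ge0_integralZl//; last 2 first.
- apply/measurable_EFinP.
  apply: (@measurableT_comp _ _ _ _ _ _ (fun x : R => x `^ _)) => //.
  exact: measurable_funD.
- by move=> x _; rewrite lee_fin powR_ge0.
by rewrite lte_mul_pinfty ?lee_fin ?powR_ge0// integral_onedx_powR//; lra.
Qed.

(** The norm of a representative [h] of the transform, so that [Hs_norm s f] is
    [hs_norm s (fourier f)]. *)
Definition hs_norm s h : \bar R :=
  Lnorm mu 2%:E (fun xi : R =>
    ((1 + xi ^+ 2) `^ (s / 2) * Num.sqrt (h.1 xi ^+ 2 + h.2 xi ^+ 2))%:E).

(** Cauchy-Schwarz: [g] is dominated by the product of the integrand of [hs_norm]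
    and of the power of [1 + xi ^+ 2] with exponent [(j - s) / 2], which is square
    integrable because [j + 1 / 2 < s]. *)
Lemma fourier_moment_bound s (j : nat) : j%:R + 2^-1 < s ->
  exists2 C : R, 0 <= C & forall h, measurable_fun setT h.1 ->
    measurable_fun setT h.2 -> (hs_norm s h < +oo)%E ->
    forall g : R -> R, measurable_fun setT g ->
      (forall xi, `|g xi| <= Num.sqrt (1 + xi ^+ 2) ^+ j *
        Num.sqrt (h.1 xi ^+ 2 + h.2 xi ^+ 2)) ->
    integr g /\ \int[mu]_xi `|g xi| <= C * fine (hs_norm s h).
Proof.
move=> js.
pose w (xi : R) := (1 + xi ^+ 2) `^ ((j%:R - s) / 2).
have mw : measurable_fun setT w by exact: measurable_bracket_powR.
have wfin : (Lnorm mu 2%:E (EFin \o w) < +oo)%E.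
  rewrite unlock poweR_lty//.
  have /integrableP[_] := @integr_bracket_powR (s - j%:R) ltac:(lra).
  apply: le_lt_trans; rewrite le_eqVlt; apply/orP; left; apply/eqP.
  apply: eq_integral => xi _ /=.
  rewrite !ger0_norm ?powR_ge0// -powRrM; congr (_ `^ _)%:E.
  by field.
exists (fine (Lnorm mu 2%:E (EFin \o w))); first by rewrite fine_ge0 ?Lnorm_ge0.
move=> h m1 m2 hfin g mg gH.
pose H xi := (1 + xi ^+ 2) `^ (s / 2) * Num.sqrt (h.1 xi ^+ 2 + h.2 xi ^+ 2).
have mH : measurable_fun setT H.
  apply: measurable_funM; first exact: measurable_bracket_powR.
  apply: (@measurableT_comp _ _ _ _ _ _ (@Num.sqrt R)).
    exact: continuous_measurable_fun (@sqrt_continuous R).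
  by apply: measurable_funD; apply: measurable_funX.
have gwH xi : `|g xi| <= w xi * H xi.
  apply: le_trans (gH xi) _; rewrite /w /H mulrA ler_wpM2r ?sqrtr_ge0//.
  have x0 : 0 < 1 + xi ^+ 2 by rewrite ltr_pwDl ?sqr_ge0.
  rewrite -powRD; last by rewrite (gt_eqF x0) implybT.
  have -> : (j%:R - s) / 2 + s / 2 = 2^-1 * j%:R by field.
  by rewrite powRrM powR12_sqrt ?addr_ge0 ?sqr_ge0// powR_mulrn ?sqrtr_ge0.
have Hfin : (Lnorm mu 2%:E (EFin \o H) < +oo)%E by [].
have le1 : (\int[mu]_xi `|g xi|%:E <=
    Lnorm mu 2%:E (EFin \o w) * Lnorm mu 2%:E (EFin \o H))%E.
  apply: le_trans (hoelder mu mw mH _ _ _) => //; last by rewrite [RHS]splitr !div1r.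
  rewrite Lnorm1; apply: ge0_le_integral => //.
  - by apply/measurable_EFinP; exact: measurableT_comp.
  - by apply: measurableT_comp => //; apply/measurable_EFinP; exact: measurable_funM.
  - move=> xi _; rewrite lee_fin (le_trans (gwH xi))//= ler_norm//.
have fin : (Lnorm mu 2%:E (EFin \o w) * Lnorm mu 2%:E (EFin \o H) < +oo)%E.
  by rewrite lte_mul_pinfty ?Lnorm_ge0// ge0_fin_numE ?Lnorm_ge0.
have ig : integr g.
  apply/integrableP; split; first exact/measurable_EFinP.
  exact: le_lt_trans fin.
split => //; rewrite -lee_fin EFinM !fineK ?ge0_fin_numE ?Lnorm_ge0//.
  exact: le_lt_trans fin.
by apply: integral_ge0 => xi _; rewrite lee_fin.
Qed.

Lemma normr_le_sqrt_sqrD1 x y : `|x| <= Num.sqrt (x ^+ 2 + y ^+ 2).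
Proof. by rewrite -sqrtr_sqr ler_wsqrtr// lerDl sqr_ge0. Qed.

Lemma normr_le_sqrt_sqrD2 x y : `|y| <= Num.sqrt (x ^+ 2 + y ^+ 2).
Proof. by rewrite addrC normr_le_sqrt_sqrD1. Qed.

Lemma fourier_of_measurable f h : fourier_of f h ->
  measurable_fun setT h.1 /\ measurable_fun setT h.2.
Proof. by case=> _ h1 h2 _; split; exact: L2_measurable. Qed.

Lemma pi2_ge1 : 1 <= 2 * pi :> R.
Proof. by have := pi_ge2 R; lra. Qed.

Lemma le_2pi_mul z w : 2 * pi * z = w -> `|z| <= `|w|.
Proof.
move=> <-; rewrite normrM ler_peMl// ger0_norm ?pi2_ge1//.
exact: le_trans pi2_ge1.
Qed.

Lemma measurable_iter_fourier_dx h (j : nat) :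
  measurable_fun setT h.1 -> measurable_fun setT h.2 ->
  measurable_fun setT (iter j fourier_dx h).1 /\
  measurable_fun setT (iter j fourier_dx h).2.
Proof.
move=> m1 m2; elim: j => [//|j [mj1 mj2]]; split => /=.
  apply: (@measurableT_comp _ _ _ _ _ _ (@GRing.opp R)) => //.
  by apply: measurable_funM.
by apply: measurable_funM.
Qed.

Lemma normr_iter_fourier_dx h (j : nat) xi :
  `|(iter j fourier_dx h).1 xi| <=
     `|xi| ^+ j * Num.sqrt (h.1 xi ^+ 2 + h.2 xi ^+ 2) /\
  `|(iter j fourier_dx h).2 xi| <=
     `|xi| ^+ j * Num.sqrt (h.1 xi ^+ 2 + h.2 xi ^+ 2).
Proof.
elim: j => [|j [IH1 IH2]] /=.
  by rewrite !mul1r normr_le_sqrt_sqrD1 normr_le_sqrt_sqrD2.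
by rewrite normrN !normrM exprS -!mulrA !ler_wpM2l.
Qed.

Lemma normr_pow_le_bracket (j n : nat) x : (j <= n)%N ->
  `|x| ^+ j <= Num.sqrt (1 + x ^+ 2) ^+ n.
Proof.
move=> jn; apply: (@le_trans _ _ (Num.sqrt (1 + x ^+ 2) ^+ j)).
  by rewrite lerXn2r ?nnegrE ?sqrtr_ge0// addrC -{1}[1](expr1n _ 2) normr_le_sqrt_sqrD1.
rewrite ler_weXn2l//.
have {1}-> : (1 : R) = Num.sqrt 1 by rewrite sqrtr1.
by rewrite ler_wsqrtr// lerDl sqr_ge0.
Qed.

(** The [j]-th derivative of [f] is the inverse transform of
    [iter j fourier_dx h], whose moduli are integrable for [j <= n]. *)
Theorem sobolev_embedding s (n : nat) : n%:R + 2^-1 < s ->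
  exists2 C : R, 0 <= C &
  forall f h, continuous f -> fourier_of f h -> (hs_norm s h < +oo)%E ->
  forall j, (j <= n)%N ->
    [/\ (j < n)%N -> forall x, derivable (derive1n j f) x 1,
        continuous (derive1n j f) &
        forall x, `|derive1n j f x| <= C * fine (hs_norm s h)].
Proof.
move=> ns; have [C C0 hC] := fourier_moment_bound ns.
exists (2 * C); first by rewrite mulr_ge0.
move=> f h cf fh hN; have [m1 m2] := fourier_of_measurable fh.
have N0 : 0 <= fine (hs_norm s h) by rewrite fine_ge0 ?Lnorm_ge0.
have tp : 2 * pi != 0 :> R by rewrite gt_eqF// (lt_le_trans _ pi2_ge1).
pose k j := iter j fourier_dx h.
have M j : (j <= n)%N -> [/\ integr (k j).1, integr (k j).2,
   \int[mu]_xi `|(k j).1 xi| <= C * fine (hs_norm s h) &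
   \int[mu]_xi `|(k j).2 xi| <= C * fine (hs_norm s h)].
  move=> jn; have [mj1 mj2] := measurable_iter_fourier_dx j m1 m2.
  have [] := hC h m1 m2 hN (k j).1 mj1.
    move=> xi; have [+ _] := normr_iter_fourier_dx h j xi => /le_trans; apply.
    by rewrite ler_wpM2r ?sqrtr_ge0// normr_pow_le_bracket.
  have [] := hC h m1 m2 hN (k j).2 mj2.
    move=> xi; have [_ +] := normr_iter_fourier_dx h j xi => /le_trans; apply.
    by rewrite ler_wpM2r ?sqrtr_ge0// normr_pow_le_bracket.
  by [].
have E j : (j <= n)%N ->
    derive1n j f = (fun x => (2 * pi)^-1 * inv_fourier (k j) x).
  elim: j => [|j IH] jn.
    have [i1 i2 _ _] := M 0 jn.
    apply/funext => x; rewrite /= -(fourier_inversion cf fh i1 i2).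
    by rewrite mulKf.
  have [i1 i2 _ _] := M j (ltnW jn); have [j1 j2 _ _] := M j.+1 jn.
  rewrite derive1nS (IH (ltnW jn)); apply/funext => x.
  exact: is_derive1_derive1 (is_derive1Z _ (is_derive1_inv_fourier x i1 i2 j1 j2)).
move=> j jn; have [i1 i2 b1 b2] := M j jn; split.
- move=> jn' x; have [j1 j2 _ _] := M j.+1 jn'; rewrite (E j jn).
  by have [] := is_derive1Z (2 * pi)^-1 (is_derive1_inv_fourier x i1 i2 j1 j2).
- rewrite (E j jn) => x; apply: cvgMr; exact: continuous_inv_fourier.
- move=> x; rewrite (E j jn).
  apply: (@le_trans _ _ `|inv_fourier (k j) x|).
    by apply: le_2pi_mul; rewrite mulVKf.
  apply: le_trans (inv_fourier_le x i1 i2) _; lra.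
Qed.

End sobolev_embedding.

(** * The inverse of 1 - d^2/dx^2 *)

Section helmholtz_inverse.
Context {R : realType}.
Local Notation mu := (@lebesgue_measure R).
Local Notation integr f := (mu.-integrable setT (EFin \o f)).
Implicit Types (f g F : R -> R) (a x y z M K : R).

Lemma continuous_exp_abs a : continuous (fun y : R => expR (- (a * `|y|))).
Proof.
move=> y; apply: (@continuous_comp _ _ _ (fun y : R => - (a * `|y|)) expR).
  by apply: cvgN; apply: cvgMr; exact: norm_continuous.
exact: continuous_expR.
Qed.

Lemma integral0y_exp a : 0 < a ->
  (\int[mu]_(y in `[0%R, +oo[) (expR (- (a * y)))%:E = (a^-1)%:E)%E.
Proof.
move=> a0.
have d y : is_derive y 1 (fun y => - a^-1 * expR (- (a * y))) (expR (- (a * y))).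
  apply: (is_derive_eq (is_derive1Z (- a^-1)
    (is_derive1_expR (is_derive1N (is_derive1_lin a y))))).
  by rewrite /=; field; rewrite gt_eqF.
rewrite (@ge0_continuous_FTC2y _ _ (fun y => - a^-1 * expR (- (a * y))) 0 0).
- by rewrite mulr0 oppr0 expR0 mulr1 EFinN sub0e oppeK.
- by move=> y _; exact: expR_ge0.
- apply: continuous_subspaceT => y.
  exact: is_derive1_continuous (is_derive1_expR (is_derive1N (is_derive1_lin a y))).
- rewrite -(mulr0 (- a^-1)); apply: cvgMr.
  apply: (@cvg_comp _ _ _ (fun y => a * y) (fun y => expR (- y)));
    last exact: cvgr_expR.
  by apply: gt0_cvgMry => //; exact: cvg_id.
- by move=> y _; have [] := d y.
- exact: cvg_at_right_filter (is_derive1_continuous (d 0)).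
- by move=> y _; exact: is_derive1_derive1 (d y).
Qed.

Lemma integral_exp_kernel a x : 0 < a ->
  integr (fun y => expR (- (a * `|x - y|))) /\
  \int[mu]_y expR (- (a * `|x - y|)) = 2 / a.
Proof.
move=> a0.
have E : (\int[mu]_y (expR (- (a * `|x - y|)))%:E = (2 / a)%:E)%E.
  have dF y : is_derive y 1 (fun y => y - x) 1.
    apply: (is_derive_eq (is_derive1B (is_derive1_id y) (is_derive1_cst x y))).
    by rewrite subr0.
  have F' : derive1 (fun y => y - x) = cst 1.
    by apply/funext => y; exact: is_derive1_derive1 (dF y).
  transitivity (\int[mu]_y (expR (- (a * `|y|)))%:E)%E; last first.
    rewrite ge0_symfun_integralT; last 3 first.
    - by move=> y; exact: expR_ge0.
    - exact: continuous_exp_abs.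
    - by move=> y /=; rewrite normrN.
    rewrite -set_itvcy EFinM -(integral0y_exp a0); congr (_ * _)%E.
    apply: eq_integral => y; rewrite inE/= in_itv/= andbT => y0.
    by rewrite ger0_norm.
  rewrite [RHS](@increasing_ge0_integration_by_substitutionT _ (fun y => y - x)
    (fun y => expR (- (a * `|y|)))).
  - by apply: eq_integral => y _; rewrite F' /= mulr1 distrC.
  - by move=> y z; rewrite ltrD2r.
  - by rewrite F'; exact: cst_continuous.
  - by rewrite F'; exact: is_cvg_cst.
  - by rewrite F'; exact: is_cvg_cst.
  - by move=> y; have [] := dF y.
  - exact: cvg_addrr_Ny.
  - exact: cvg_addrr.
  - exact: continuous_exp_abs.
  - by move=> y; exact: expR_ge0.
split; last by rewrite /Rintegral E.
apply/integrableP; split.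
  apply/measurable_EFinP; apply: continuous_measurable_fun => y.
  apply: (@continuous_comp _ _ _ (fun y => x - y) (fun y => expR (- (a * `|y|)))).
    by apply: cvgB; [exact: cvg_cst|exact: cvg_id].
  exact: continuous_exp_abs.
under eq_integral do rewrite /= ger0_norm ?expR_ge0//.
by rewrite E ltry.
Qed.

(** The convolutions with the two halves of [expR (- `|x|)].  They solve
    A' = f - A and B' = B - f, so [(A + B) / 2] inverts 1 - d^2/dx^2 and
    [(B - A) / 2] is its derivative. *)
Definition exp_left f x := expR (- x) * \int[mu]_(y in `]-oo, x]) (expR y * f y).
Definition exp_right f x := expR x * \int[mu]_(y in `]x, +oo[) (expR (- y) * f y).
Definition dDm2 f x := (exp_right f x - exp_left f x) / 2.

Section bounded_continuous.
Variables (f : R -> R) (M : R).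
Hypotheses (cf : continuous f) (fM : forall x, `|f x| <= M).

Lemma integr_exp_kernelM x : integr (fun y => expR (- `|x - y|) * f y).
Proof.
have [+ _] := integral_exp_kernel x ltr01.
under eq_fun do rewrite mul1r.
by move=> ik; exact: (@integrM_bounded _ _ _ M ik (continuous_measurable_fun cf)).
Qed.

Lemma integrable_exp_left x :
  mu.-integrable `]-oo, x] (EFin \o (fun y => expR y * f y)).
Proof.
have := integr_itv `]-oo, x] (integrZ (expR x) (integr_exp_kernelM x)).
apply: eq_integrable => // y; rewrite inE/= in_itv/= => yx.
by rewrite mulrA -expRD ger0_norm ?subr_ge0// opprB addrC subrK.
Qed.

Lemma integrable_exp_right x :
  mu.-integrable `]x, +oo[ (EFin \o (fun y => expR (- y) * f y)).
Proof.
have := integr_itv `]x, +oo[ (integrZ (expR (- x)) (integr_exp_kernelM x)).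
apply: eq_integrable => // y; rewrite inE/= in_itv/= andbT => yx.
by rewrite mulrA -expRD ltr0_norm ?subr_lt0// opprK addrA addNr add0r.
Qed.

Lemma Dm2E x : Dm2 f x = (exp_left f x + exp_right f x) / 2.
Proof.
rewrite /Dm2.
under eq_Rintegral do rewrite -mulrA.
rewrite RintegralZl//; last exact: integr_exp_kernelM.
rewrite mulrC; congr (_ * _).
have TE : [set: R] = `]-oo, x] `|` `]x, +oo[.
  by rewrite -itv_bndbnd_setU// set_itvE.
rewrite [in LHS]TE Rintegral_setU//; last 2 first.
- by rewrite -TE; exact: integr_exp_kernelM.
- apply/disj_setPS => y [/=]; rewrite !in_itv/= andbT => yx xy.
  by have := lt_le_trans xy yx; rewrite ltxx.
congr (_ + _).
- rewrite /exp_left -RintegralZl//; last exact: integrable_exp_left.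
  apply: eq_Rintegral => y; rewrite inE/= in_itv/= => yx.
  by rewrite mulrA -expRD ger0_norm ?subr_ge0// opprB addrC.
- rewrite /exp_right -RintegralZl//; last exact: integrable_exp_right.
  apply: eq_Rintegral => y; rewrite inE/= in_itv/= andbT => yx.
  by rewrite mulrA -expRD ltr0_norm ?subr_lt0// opprK.
Qed.

Lemma is_derive1_exp_left x : is_derive x 1 (exp_left f) (f x - exp_left f x).
Proof.
have cg y : {for y, continuous (fun y => expR y * f y)}.
  by apply: cvgM; [exact: continuous_expR|exact: cf].
have x1 : x < x + 1 by rewrite ltrDl.
have [d dE] := @continuous_FTC1 _ (fun y => expR y * f y) (BInfty _ true) x (x + 1)
  x1 (integrable_exp_left (x + 1)) (ltNyr _) (cg x).
have := derivable_is_derive1 d; rewrite dE => {}d.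
apply: (is_derive_eq (is_derive1M (is_derive1_expR (is_derive1N (is_derive1_id x))) d)).
by rewrite /exp_left mulrA -expRD addNr expR0 mul1r; ring.
Qed.

Lemma is_derive1_exp_right x : is_derive x 1 (exp_right f) (exp_right f x - f x).
Proof.
have cg y : {for y, continuous (fun y => expR (- y) * f y)}.
  apply: cvgM; last exact: cf.
  exact: is_derive1_continuous (is_derive1_expR (is_derive1N (is_derive1_id y))).
(* near x, the tail from z is the tail from x - 1 minus the part up to z *)
have ig := @integrable_exp_right (x - 1).
have ig2 : mu.-integrable `]x - 1, x + 1] (EFin \o (fun y => expR (- y) * f y)).
  apply: integrableS ig => //; apply: subset_itvl; rewrite bnd_simp//.
have x1 : x < x + 1 by rewrite ltrDl.
have x2 : (BRight (x - 1) < BRight x)%O by rewrite bnd_simp gtrBl.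
have [d dE] := @continuous_FTC1 _ (fun y => expR (- y) * f y) (BRight (x - 1)) x (x + 1)
  x1 ig2 x2 (cg x).
have := derivable_is_derive1 d; rewrite dE => {}d.
have d2 := is_derive1B
  (is_derive1_cst (\int[mu]_(y in `]x - 1, +oo[) (expR (- y) * f y)) x) d.
have d3 : is_derive x 1 (fun x => \int[mu]_(y in `]x, +oo[) (expR (- y) * f y))
    (0 - expR (- x) * f x).
  apply: near_eq_is_derive d2 => //.
  near=> z; rewrite Rintegral_itvB// bnd_simp.
  by apply: ltW; near: z; apply: lt_nbhsr; rewrite gtrBl.
apply: (is_derive_eq (is_derive1M (is_derive1_expR (is_derive1_id x)) d3)).
by rewrite sub0r mulr1 mulrN mulrA -expRD subrr expR0 mul1r.
Unshelve. all: end_near. Qed.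

Lemma is_derive1_Dm2 x : is_derive x 1 (Dm2 f) (dDm2 f x).
Proof.
have -> : Dm2 f = (fun x => 2^-1 * (exp_left f x + exp_right f x)).
  by apply/funext => y; rewrite Dm2E mulrC.
apply: (is_derive_eq (is_derive1Z _ (is_derive1D (is_derive1_exp_left x)
  (is_derive1_exp_right x)))).
by rewrite /dDm2; field.
Qed.

Lemma is_derive1_dDm2 x : is_derive x 1 (dDm2 f) (Dm2 f x - f x).
Proof.
have -> : dDm2 f = (fun x => 2^-1 * (exp_right f x - exp_left f x)).
  by apply/funext => y; rewrite mulrC.
apply: (is_derive_eq (is_derive1Z _ (is_derive1B (is_derive1_exp_right x)
  (is_derive1_exp_left x)))).
by rewrite Dm2E; field.
Qed.

End bounded_continuous.

End helmholtz_inverse.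

Section helmholtz_bounds.
Context {R : realType}.
Local Notation mu := (@lebesgue_measure R).
Local Notation integr f := (mu.-integrable setT (EFin \o f)).
Implicit Types (f g F : R -> R) (a x y z M K : R).

(** [e] is a multiple of [expR (a * x)], which is unbounded. *)
Lemma bounded_exp_eq0 (e : R -> R) (a M : R) : a != 0 ->
  (forall x, is_derive x 1 e (a * e x)) -> (forall x, `|e x| <= M) ->
  forall x, e x = 0.
Proof.
move=> a0 de eM x0.
have dg x : is_derive x 1 (fun x => e x * expR (- (a * x))) 0.
  apply: (is_derive_eq (is_derive1M (de x)
    (is_derive1_expR (is_derive1N (is_derive1_lin a x))))).
  by ring.
have E x : e x = e x0 * expR (- (a * x0)) * expR (a * x).
  rewrite -[e x]mulr1 -[1 in LHS]expR0 -(addNr (a * x)) expRD mulrA; congr (_ * _).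
  exact: (@is_derive_0_is_cst _ _ x x0 dg).
apply/eqP/negP => /negP e0.
set c := e x0 * expR (- (a * x0)).
have c0 : 0 < `|c| by rewrite normr_gt0 mulf_neq0// gt_eqF// expR_gt0.
have M0 : 0 <= M by apply: le_trans (eM 0).
have := eM (M / `|c| / a); rewrite E -/c normrM (ger0_norm (expR_ge0 _)).
rewrite mulrC -ler_pdivlMr// [a * _]mulrC divfK// leNgt => /negP; apply.
by apply: lt_le_trans (expR_ge1Dx _); rewrite ltrDr ltr01.
Qed.

Section bounds.
Variables (f : R -> R) (M : R).
Hypotheses (cf : continuous f) (fM : forall x, `|f x| <= M).

Let cnf : continuous (fun x => `|f x|).
Proof.
move=> x; apply: (@continuous_comp _ _ _ f (@Num.norm _ R)); first exact: cf.
exact: norm_continuous.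
Qed.

Let nfM x : `| (`|f x|) | <= M. Proof. by rewrite normr_id. Qed.

Lemma normr_exp_left_right x :
  `|exp_left f x| + `|exp_right f x| <= 2 * Dm2 (fun y => `|f y|) x.
Proof.
rewrite (Dm2E cnf nfM) mulrC divfK// lerD//.
  rewrite /exp_left normrM (ger0_norm (expR_ge0 _)) ler_wpM2l ?expR_ge0//.
  apply: (le_trans (le_normr_Rintegral _ (integrable_exp_left cf fM x))) => //.
  rewrite le_eqVlt; apply/orP; left; apply/eqP; apply: eq_Rintegral => y _.
  by rewrite normrM (ger0_norm (expR_ge0 _)).
rewrite /exp_right normrM (ger0_norm (expR_ge0 _)) ler_wpM2l ?expR_ge0//.
apply: (le_trans (le_normr_Rintegral _ (integrable_exp_right cf fM x))) => //.
rewrite le_eqVlt; apply/orP; left; apply/eqP; apply: eq_Rintegral => y _.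
by rewrite normrM (ger0_norm (expR_ge0 _)).
Qed.

Lemma normr_Dm2_le x : `|Dm2 f x| <= Dm2 (fun y => `|f y|) x.
Proof.
rewrite (Dm2E cf fM) normrM [ `|2^-1|]ger0_norm//.
rewrite ler_pdivrMr// [leRHS]mulrC.
exact: le_trans (ler_normD _ _) (normr_exp_left_right x).
Qed.

Lemma normr_dDm2_le x : `|dDm2 f x| <= Dm2 (fun y => `|f y|) x.
Proof.
rewrite /dDm2 normrM [ `|2^-1|]ger0_norm//.
rewrite ler_pdivrMr// [leRHS]mulrC.
apply: le_trans (ler_normB _ _) _; rewrite addrC.
exact: normr_exp_left_right.
Qed.

(** By the triangle inequality [expR (- `|x - y|)] times the weight at [y] is at
    most [expR (- ((1 - theta) * `|x - y|))] times the weight at [x].  The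
    constant [eps] keeps the weight bounded from below, which makes weighted
    suprema of bounded functions finite. *)
Lemma Dm2_abs_exp_weight theta eps K : 0 <= theta -> theta < 1 -> 0 <= eps ->
  0 <= K ->
  (forall y, `|f y| <= K * (expR (- (theta * `|y|)) + eps)) ->
  forall x, Dm2 (fun y => `|f y|) x <=
    K / (1 - theta) * (expR (- (theta * `|x|)) + eps).
Proof.
move=> t0 t1 e0 K0 fK x.
have t10 : 0 < 1 - theta by rewrite subr_gt0.
have [ik Ek] := integral_exp_kernel x t10.
pose C := 2^-1 * (K * (expR (- (theta * `|x|)) + eps)).
have -> : K / (1 - theta) * (expR (- (theta * `|x|)) + eps) =
    \int[mu]_y (C * expR (- ((1 - theta) * `|x - y|))).
  rewrite RintegralZl// Ek /C; field; rewrite subr_eq0 gt_eqF//.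
rewrite /Dm2; apply: le_Rintegral => //.
- under eq_fun do rewrite -mulrA.
  exact: integrZ (integr_exp_kernelM cnf nfM x).
- exact: integrZ.
move=> y _; rewrite /C -!mulrA ler_wpM2l ?invr_ge0// mulrC.
apply: (@le_trans _ _ (K * (expR (- (theta * `|y|)) + eps) * expR (- `|x - y|))).
  by rewrite ler_wpM2r ?expR_ge0.
rewrite -mulrA ler_wpM2l// !mulrDl -!expRD.
have tri : `|x| <= `|y| + `|x - y|.
  by rewrite -{1}[x](subrK y) addrC ler_normD.
have n0 := normr_ge0 (x - y).
apply: lerD; first by rewrite ler_expR; nra.
by rewrite ler_wpM2l// ler_expR; nra.
Qed.

End bounds.

Lemma Dm2_le_cst f M : continuous f -> (forall x, `|f x| <= M) ->
  forall x, `|Dm2 f x| <= M /\ `|dDm2 f x| <= M.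
Proof.
move=> cf fM x; have M0 : 0 <= M by apply: le_trans (fM 0).
have h : forall y, `|f y| <= M * (expR (- (0 * `|y|)) + 0).
  by move=> y; rewrite mul0r oppr0 expR0 addr0 mulr1.
have := Dm2_abs_exp_weight cf fM (lexx 0) ltr01 (lexx 0) M0 h x.
rewrite mul0r oppr0 expR0 !addr0 divr1 mulr1 => b.
split; first exact: le_trans (normr_Dm2_le cf fM x) b.
exact: le_trans (normr_dDm2_le cf fM x) b.
Qed.

(** With A and B the two halves of the convolution, integration by parts says
    that A(F') = F - A(F) and B(F') = B(F) - F.  In each identity the difference
    of the two sides is bounded and solves e' = - e, respectively e' = e, so it
    vanishes; no integral has to be transformed. *)
Lemma Dm2_derive1 F M : (forall x, derivable F x 1) -> continuous (derive1 F) ->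
  (forall x, `|F x| <= M) -> (forall x, `|derive1 F x| <= M) ->
  Dm2 (derive1 F) = dDm2 F.
Proof.
move=> dF cF' FM F'M.
have dF1 x := derivable_is_derive1 (dF x).
have cF : continuous F by move=> x; exact: is_derive1_continuous (dF1 x).
have bd (g : R -> R) x : continuous g -> (forall x, `|g x| <= M) ->
    `|exp_left g x| <= 2 * M /\ `|exp_right g x| <= 2 * M.
  move=> cg gM; have lr := normr_exp_left_right cg gM x.
  have cng : continuous (fun x => `|g x|).
    move=> z; apply: (@continuous_comp _ _ _ g (@Num.norm _ R)); first exact: cg.
    exact: norm_continuous.
  have ngM z : `| (`|g z|) | <= M by rewrite normr_id.
  have [+ _] := Dm2_le_cst cng ngM x.
  move=> /(le_trans (ler_norm _)) DM.
  have {}DM : 2 * Dm2 (fun y => `|g y|) x <= 2 * M by rewrite ler_wpM2l.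
  have {}DM : `|exp_left g x| + `|exp_right g x| <= 2 * M by exact: le_trans DM.
  by split; apply: le_trans DM; [rewrite lerDl|rewrite lerDr]; exact: normr_ge0.
have E1 x : exp_left (derive1 F) x - F x + exp_left F x = 0.
  apply: (@bounded_exp_eq0
    (fun x => exp_left (derive1 F) x - F x + exp_left F x) (-1) (5 * M)).
  - by rewrite oppr_eq0 oner_eq0.
  - move=> y; apply: (is_derive_eq (is_derive1D (is_derive1B
      (is_derive1_exp_left cF' F'M y) (dF1 y)) (is_derive1_exp_left cF FM y))).
    by ring.
  - move=> y; have [b1 _] := bd _ y cF' F'M; have [b2 _] := bd _ y cF FM.
    have := FM y; move: b1 b2; rewrite !ler_norml => /andP[? ?] /andP[? ?] /andP[? ?].
    by apply/andP; split; lra.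
have E2 x : exp_right (derive1 F) x + F x - exp_right F x = 0.
  apply: (@bounded_exp_eq0
    (fun x => exp_right (derive1 F) x + F x - exp_right F x) 1 (5 * M)).
  - by rewrite oner_eq0.
  - move=> y; apply: (is_derive_eq (is_derive1B (is_derive1D
      (is_derive1_exp_right cF' F'M y) (dF1 y)) (is_derive1_exp_right cF FM y))).
    by ring.
  - move=> y; have [_ b1] := bd _ y cF' F'M; have [_ b2] := bd _ y cF FM.
    have := FM y; move: b1 b2; rewrite !ler_norml => /andP[? ?] /andP[? ?] /andP[? ?].
    by apply/andP; split; lra.
apply/funext => x; rewrite (Dm2E cF' F'M) /dDm2; congr (_ / _).
by have := E1 x; have := E2 x; lra.
Qed.

End helmholtz_bounds.

(** * Bounds for the nonlinearity *)

Section bounded_functions.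
Context {R : realType}.
Implicit Types (f g : R -> R).

Definition bounded_fct f := exists M, forall x, `|f x| <= M.

Lemma bounded_fct_cst r : bounded_fct (fun=> r).
Proof. by exists `|r|. Qed.

Lemma bounded_fctD f g : bounded_fct f -> bounded_fct g ->
  bounded_fct (fun x => f x + g x).
Proof.
move=> [M fM] [N gN]; exists (M + N) => x.
by rewrite (le_trans (ler_normD _ _))// lerD.
Qed.

Lemma bounded_fctN f : bounded_fct f -> bounded_fct (fun x => - f x).
Proof. by move=> [M fM]; exists M => x; rewrite normrN. Qed.

Lemma bounded_fctM f g : bounded_fct f -> bounded_fct g ->
  bounded_fct (fun x => f x * g x).
Proof.
move=> [M fM] [N gN]; exists (M * N) => x.
by rewrite normrM ler_pM.
Qed.

Lemma bounded_fctX f n : bounded_fct f -> bounded_fct (fun x => f x ^+ n).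
Proof.
move=> [M fM]; exists (M ^+ n) => x.
by rewrite normrX lerXn2r ?nnegrE// (le_trans _ (fM x)).
Qed.

Lemma continuousDf f g : continuous f -> continuous g ->
  continuous (fun x => f x + g x).
Proof. by move=> cf cg x; apply: cvgD; [exact: cf|exact: cg]. Qed.

Lemma continuousNf f : continuous f -> continuous (fun x => - f x).
Proof. by move=> cf x; apply: cvgN; exact: cf. Qed.

Lemma continuousMf f g : continuous f -> continuous g ->
  continuous (fun x => f x * g x).
Proof. by move=> cf cg x; apply: cvgM; [exact: cf|exact: cg]. Qed.

Lemma continuousXf f n : continuous f -> continuous (fun x => f x ^+ n).
Proof.
move=> cf x; apply: (@continuous_comp _ _ _ f (fun y => y ^+ n)); first exact: cf.
exact: exprn_continuous.
Qed.

Lemma continuous_cstf (r : R) : continuous (fun _ : R => r).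
Proof. by move=> x; exact: cvg_cst. Qed.

End bounded_functions.

Ltac bounded_polynomial :=
  cbv beta;
  lazymatch goal with
  | |- bounded_fct (fun _ => ?r) => exact (bounded_fct_cst r)
  | |- bounded_fct (fun x => (@?f x - @?g x)%R) =>
      refine (@bounded_fctD _ f (fun x => - g x) _ _);
        [|refine (@bounded_fctN _ g _)]; bounded_polynomial
  | |- bounded_fct (fun x => (@?f x + @?g x)%R) =>
      refine (@bounded_fctD _ f g _ _); bounded_polynomial
  | |- bounded_fct (fun x => (@?f x * @?g x)%R) =>
      refine (@bounded_fctM _ f g _ _); bounded_polynomial
  | |- bounded_fct (fun x => (@?f x ^+ ?n)%R) =>
      refine (@bounded_fctX _ f n _); bounded_polynomial
  | |- bounded_fct (fun x => ?h x) =>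
      match goal with H : bounded_fct h |- _ => exact H end
  end.


Ltac continuous_polynomial :=
  cbv beta;
  lazymatch goal with
  | |- continuous (fun _ => ?r) => exact (@continuous_cstf _ r)
  | |- continuous (fun x => (@?f x - @?g x)%R) =>
      refine (@continuousDf _ f (fun x => - g x) _ _);
        [|refine (@continuousNf _ g _)]; continuous_polynomial
  | |- continuous (fun x => (@?f x + @?g x)%R) =>
      refine (@continuousDf _ f g _ _); continuous_polynomial
  | |- continuous (fun x => (@?f x * @?g x)%R) =>
      refine (@continuousMf _ f g _ _); continuous_polynomial
  | |- continuous (fun x => (@?f x ^+ ?n)%R) =>
      refine (@continuousXf _ f n _); continuous_polynomial
  | |- continuous (fun x => ?h x) =>
      match goal with H : continuous h |- _ => exact H end
  end.

Section kabc_bounds.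
Context {R : realType}.
Implicit Types (w : R -> R) (a b c x y P : R).

Definition C2_bounded P w := [/\ forall x, derivable w x 1,
  forall x, derivable (derive1 w) x 1, continuous (derive1n 2 w) &
  forall x, [/\ `|w x| <= P, `|derive1 w x| <= P & `|derive1n 2 w x| <= P]].

(** Two factors give [q ^+ 2], and the remaining ones are bounded by [P]. *)
Lemma monomial_bound (i j n : nat) (q P x y : R) : 1 <= P -> q <= P ->
  `|x| <= q -> `|y| <= q -> (2 <= i + j <= n)%N ->
  `|x ^+ i * y ^+ j| <= P ^+ n * q ^+ 2.
Proof.
move=> P1 qP xq yq /andP[ij2 ijn].
have q0 : 0 <= q by apply: le_trans xq.
rewrite normrM !normrX.
apply: (@le_trans _ _ (q ^+ i * q ^+ j)).
  by rewrite ler_pM ?exprn_ge0// lerXn2r ?nnegrE.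
rewrite -exprD -(subnK ij2) exprD ler_wpM2r ?sqr_ge0//.
apply: (@le_trans _ _ (P ^+ (i + j - 2))).
  by rewrite lerXn2r ?nnegrE// (le_trans ler01).
by rewrite ler_weXn2l//; lia.
Qed.

Section fixed_profile.
Variables (k : nat) (a b c P : R) (w : R -> R).
Hypotheses (hk : (2 <= k)%N) (hP : 1 <= P) (hw : C2_bounded P w).
Local Notation w' := (derive1 w).
Local Notation w'' := (derive1n 2 w).

Let dw x : is_derive x 1 w (w' x).
Proof. by case: hw => h _ _ _; exact: derivable_is_derive1. Qed.
Let dw' x : is_derive x 1 w' (w'' x).
Proof. by case: hw => _ h _ _; exact: derivable_is_derive1. Qed.
Let cw : continuous w.
Proof. by move=> x; exact: is_derive1_continuous (dw x). Qed.
Let cw' : continuous w'.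
Proof. by move=> x; exact: is_derive1_continuous (dw' x). Qed.
Let cw'' : continuous w''. Proof. by case: hw. Qed.
Let bw : bounded_fct w. Proof. by case: hw => _ _ _ h; exists P => x; case: (h x). Qed.
Let bw' : bounded_fct w'.
Proof. by case: hw => _ _ _ h; exists P => x; case: (h x). Qed.
Let bw'' : bounded_fct w''.
Proof. by case: hw => _ _ _ h; exists P => x; case: (h x). Qed.

Let dflux x : is_derive x 1 (kabc_flux k a b c w) _ :=
  is_derive1B (is_derive1D
    (is_derive1Z (b / (k%:R + 1)) (is_derive1X (k + 1) (dw x)))
    (is_derive1M (is_derive1Z c (is_derive1X (k - 1) (dw x))) (is_derive1X 2 (dw' x))))
    (is_derive1M (is_derive1Z (a * (k%:R - 2)) (is_derive1X (k - 3) (dw x)))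
                 (is_derive1X 4 (dw' x))).

Lemma derivable_kabc_flux x : derivable (kabc_flux k a b c w) x 1.
Proof. by have [] := dflux x. Qed.

Let derive1_flux : derive1 (kabc_flux k a b c w) = _ :=
  funext (fun x => is_derive1_derive1 (dflux x)).

Let bounded_derive1_flux : bounded_fct (derive1 (kabc_flux k a b c w)).
Proof.
rewrite derive1_flux.
bounded_polynomial.
Qed.

Let continuous_derive1_flux : continuous (derive1 (kabc_flux k a b c w)).
Proof.
rewrite derive1_flux.
continuous_polynomial.
Qed.

Let bounded_flux : bounded_fct (kabc_flux k a b c w).
Proof.
rewrite /kabc_flux.
bounded_polynomial.
Qed.

Let continuous_flux : continuous (kabc_flux k a b c w).
Proof. by move=> x; exact: is_derive1_continuous (dflux x). Qed.

Let bounded_source : bounded_fct (kabc_source k a b c w).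
Proof.
rewrite /kabc_source.
bounded_polynomial.
Qed.

Let continuous_source : continuous (kabc_source k a b c w).
Proof.
rewrite /kabc_source.
continuous_polynomial.
Qed.

(** The local part of [kabc_spatial], and the formula for its derivative. *)
Definition kabc_local x := w x ^+ k * w' x - a * w x ^+ (k - 2) * w' x ^+ 3.

Definition kabc_dlocal x :=
  k%:R * w x ^+ (k - 1) * w' x ^+ 2 + w x ^+ k * w'' x
  - a * ((k - 2)%:R * w x ^+ (k - 3) * w' x ^+ 4
         + 3 * w x ^+ (k - 2) * w' x ^+ 2 * w'' x).

(** The derivative inside [Dm2] moves onto the kernel: only then do the bounds
    involve the flux itself, which is a polynomial in [w] and [derive1 w]. *)
Lemma kabc_spatialE x : kabc_spatial k a b c w x =
  kabc_local x + dDm2 (kabc_flux k a b c w) x + Dm2 (kabc_source k a b c w) x.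
Proof.
have [M FM] := bounded_flux; have [M' F'M] := bounded_derive1_flux.
have E : Dm2 (derive1 (kabc_flux k a b c w)) = dDm2 (kabc_flux k a b c w).
  apply: (@Dm2_derive1 _ _ (Num.max M M')).
  - exact: derivable_kabc_flux.
  - exact: continuous_derive1_flux.
  - by move=> y; rewrite le_max FM.
  - by move=> y; rewrite le_max F'M orbT.
by rewrite /kabc_spatial E.
Qed.

(** The second derivative of [Dm2 F] is [Dm2 F - F], so that one more derivative
    in [x] costs at most [w''], which occurs linearly. *)
Lemma is_derive1_kabc_spatial x : is_derive x 1 (kabc_spatial k a b c w)
  (kabc_dlocal x + (Dm2 (kabc_flux k a b c w) x - kabc_flux k a b c w x)
   + dDm2 (kabc_source k a b c w) x).
Proof.
have [M FM] := bounded_flux; have [M' GM] := bounded_source.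
have -> : kabc_spatial k a b c w = (fun x => kabc_local x +
    dDm2 (kabc_flux k a b c w) x + Dm2 (kabc_source k a b c w) x).
  by apply/funext => y; exact: kabc_spatialE.
apply: is_derive1D; last exact: (is_derive1_Dm2 continuous_source GM).
apply: is_derive1D; last exact: (is_derive1_dDm2 continuous_flux FM).
apply: (is_derive_eq (is_derive1B
  (is_derive1M (is_derive1X k (dw x)) (dw' x))
  (is_derive1M (is_derive1Z a (is_derive1X (k - 2) (dw x))) (is_derive1X 3 (dw' x))))).
rewrite /kabc_dlocal -!subn1 -subnDA/=; ring.
Qed.

Definition kabc_flux_coef : R := `|b / (k%:R + 1)| + `|c| + `|a * (k%:R - 2)|.
Definition kabc_source_coef : R :=
  `|k%:R * (k%:R + 2) - 8 * a - b - c * (k%:R + 1)| + `|3 * a * (k%:R - 2)| * P.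

Let q x := `|w x| + `|w' x|.
(* k + 4 exceeds the degree in w and w' of every monomial *)
Let Q := (2 * P) ^+ (k + 4).

Let q_le x :
  [/\ `|w x| <= q x, `|w' x| <= q x, q x <= 2 * P, 1 <= 2 * P & `|w'' x| <= P].
Proof.
case: hw => _ _ _ /(_ x)[h1 h2 h3]; rewrite /q lerDl lerDr !normr_ge0.
have hP1 := hP.
split => //; [rewrite /= ; lra|lra].
Qed.

Let mono i j x : (2 <= i + j <= k + 4)%N ->
  `|w x ^+ i * w' x ^+ j| <= Q * q x ^+ 2.
Proof. by have [h1 h2 h3 h4 _] := q_le x; exact: monomial_bound. Qed.

Lemma normr_kabc_flux_le x :
  `|kabc_flux k a b c w x| <= kabc_flux_coef * (Q * q x ^+ 2).
Proof.
rewrite /kabc_flux /kabc_flux_coef !mulrDl -!mulrA.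
apply: le_trans (ler_normB _ _) _; apply: lerD; last first.
  by rewrite mulrA normrM ler_wpM2l//; apply: mono; lia.
apply: le_trans (ler_normD _ _) _; apply: lerD.
  rewrite mulrA normrM ler_wpM2l// -[w x ^+ _]mulr1 -(expr0 (w' x)).
  by apply: mono; lia.
by rewrite normrM ler_wpM2l//; apply: mono; lia.
Qed.

Lemma normr_kabc_source_le x :
  `|kabc_source k a b c w x| <= kabc_source_coef * (Q * q x ^+ 2).
Proof.
have [_ _ _ _ w2P] := q_le x.
rewrite /kabc_source /kabc_source_coef [leRHS]mulrDl.
apply: le_trans (ler_normB _ _) _; apply: lerD.
  by rewrite -mulrA normrM ler_wpM2l//; apply: mono; lia.
have -> : 3 * a * (k%:R - 2) * w x ^+ (k - 3) * w' x ^+ 3 * w'' x =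
    (3 * a * (k%:R - 2)) * (w'' x * (w x ^+ (k - 3) * w' x ^+ 3)) by ring.
rewrite normrM -[leRHS]mulrA ler_wpM2l// normrM ler_pM//; apply: mono; lia.
Qed.

Lemma normr_kabc_local_le x :
  `|kabc_local x| <= (1 + `|a|) * (Q * q x ^+ 2).
Proof.
rewrite /kabc_local [leRHS]mulrDl mul1r.
apply: le_trans (ler_normB _ _) _; apply: lerD.
  by rewrite -[w' x]expr1; apply: mono; lia.
by rewrite -mulrA normrM ler_wpM2l//; apply: mono; lia.
Qed.

Lemma normr_kabc_dlocal_le x :
  `|kabc_dlocal x| <= (k%:R + P + `|a| * (k%:R + 3 * P)) * (Q * q x ^+ 2).
Proof.
have [_ _ _ _ w2P] := q_le x.
rewrite /kabc_dlocal [leRHS]mulrDl.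
apply: le_trans (ler_normB _ _) _; apply: lerD.
  rewrite [leRHS]mulrDl; apply: le_trans (ler_normD _ _) _; apply: lerD.
    by rewrite -mulrA normrM ger0_norm// ler_wpM2l//; apply: mono; lia.
  rewrite normrM mulrC ler_pM//.
  by rewrite -[w x ^+ _]mulr1 -(expr0 (w' x)); apply: mono; lia.
rewrite normrM -[leRHS]mulrA ler_wpM2l// [leRHS]mulrDl.
apply: le_trans (ler_normD _ _) _; apply: lerD.
  rewrite -mulrA normrM ger0_norm// ler_pM// ?ler_nat ?leq_subr//.
  by apply: mono; lia.
have -> : 3 * w x ^+ (k - 2) * w' x ^+ 2 * w'' x =
    3 * (w'' x * (w x ^+ (k - 2) * w' x ^+ 2)) by ring.
rewrite normrM ger0_norm// -[leRHS]mulrA ler_wpM2l// normrM ler_pM//.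
apply: mono; lia.
Qed.

Definition kabc_const : R := ((1 + `|a|) + (k%:R + P + `|a| * (k%:R + 3 * P))
  + 2 * kabc_flux_coef + kabc_source_coef) * Q.

Lemma kabc_const_ge0 : 0 <= kabc_const.
Proof.
have P0 : 0 <= P := le_trans ler01 hP.
by rewrite /kabc_const mulr_ge0 ?exprn_ge0 ?mulr_ge0//
  ?(addr_ge0, mulr_ge0, normr_ge0, ler0n, P0).
Qed.

(** Every term of the nonlinearity has degree at least two in [w] and
    [derive1 w], the powers [k - 3] being multiplied by at least three further
    factors.  Hence a bound on the square of [`|w| + `|derive1 w|] suffices. *)
Lemma kabc_spatial_le theta eps K : 0 <= theta -> theta < 1 -> 0 <= eps ->
  0 <= K -> (forall y, q y ^+ 2 <= K * (expR (- (theta * `|y|)) + eps)) ->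
  forall x,
    `|kabc_spatial k a b c w x| <=
      kabc_const * K / (1 - theta) * (expR (- (theta * `|x|)) + eps) /\
    `|derive1 (kabc_spatial k a b c w) x| <=
      kabc_const * K / (1 - theta) * (expR (- (theta * `|x|)) + eps).
Proof.
move=> t0 t1 e0 K0 hq x.
have P0 : 0 <= P := le_trans ler01 hP.
have [M FM] := bounded_flux; have [M' GM] := bounded_source.
have t10 : 0 < 1 - theta by rewrite subr_gt0.
have Q0 : 0 <= Q by rewrite exprn_ge0// mulr_ge0.
pose d y := expR (- (theta * `|y|)) + eps.
have d0 y : 0 <= d y by rewrite addr_ge0// expR_ge0.
have cF0 : 0 <= kabc_flux_coef by rewrite !addr_ge0.
have cG0 : 0 <= kabc_source_coef by rewrite !addr_ge0// mulr_ge0.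
have Qq y : Q * q y ^+ 2 <= Q * K * d y by rewrite -mulrA ler_wpM2l.
have Fd y : `|kabc_flux k a b c w y| <= kabc_flux_coef * (Q * K) * d y.
  apply: le_trans (normr_kabc_flux_le y) _.
  by rewrite -mulrA ler_wpM2l.
have Gd y : `|kabc_source k a b c w y| <= kabc_source_coef * (Q * K) * d y.
  apply: le_trans (normr_kabc_source_le y) _.
  by rewrite -mulrA ler_wpM2l.
have QK0 : 0 <= Q * K by rewrite mulr_ge0.
have DF := Dm2_abs_exp_weight continuous_flux FM t0 t1 e0 (mulr_ge0 cF0 QK0) Fd x.
have DG := Dm2_abs_exp_weight continuous_source GM t0 t1 e0 (mulr_ge0 cG0 QK0) Gd x.
have F1 := normr_Dm2_le continuous_flux FM x.
have F2 := normr_dDm2_le continuous_flux FM x.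
have G1 := normr_Dm2_le continuous_source GM x.
have G2 := normr_dDm2_le continuous_source GM x.
have L1 := normr_kabc_local_le x.
have L2 := normr_kabc_dlocal_le x.
set D := Q * K / (1 - theta) * d x.
have inv1 : 1 <= (1 - theta)^-1 by rewrite invf_ge1//; lra.
have QD : Q * q x ^+ 2 <= D.
  apply: le_trans (Qq x) _; rewrite /D [leRHS]mulrAC ler_peMr//.
  by rewrite mulr_ge0.
have D0 : 0 <= D by rewrite !mulr_ge0 ?invr_ge0// ltW.
have DF' : Dm2 (fun y => `|kabc_flux k a b c w y|) x <= kabc_flux_coef * D.
  apply: le_trans DF _; rewrite /D -/(d x) le_eqVlt; apply/orP; left; apply/eqP; ring.
have DG' : Dm2 (fun y => `|kabc_source k a b c w y|) x <= kabc_source_coef * D.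
  apply: le_trans DG _; rewrite /D -/(d x) le_eqVlt; apply/orP; left; apply/eqP; ring.
have FQ := normr_kabc_flux_le x.
rewrite -/(d x).
have -> : kabc_const * K / (1 - theta) * d x =
    ((1 + `|a|) + (k%:R + P + `|a| * (k%:R + 3 * P))
  + 2 * kabc_flux_coef + kabc_source_coef) * D by rewrite /kabc_const /D; ring.
have l1 : (1 + `|a|) * (Q * q x ^+ 2) <= (1 + `|a|) * D by rewrite ler_wpM2l// addr_ge0.
have kP0 : 0 <= k%:R + P + `|a| * (k%:R + 3 * P).
  by rewrite ?(addr_ge0, mulr_ge0, normr_ge0, ler0n, P0).
have l2 := ler_wpM2l kP0 QD.
have l3 := ler_wpM2l cF0 QD.
have m1 : 0 <= (1 + `|a|) * D by rewrite mulr_ge0// addr_ge0.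
have m2 : 0 <= (k%:R + P + `|a| * (k%:R + 3 * P)) * D by rewrite mulr_ge0.
have m3 : 0 <= kabc_flux_coef * D by rewrite mulr_ge0.
split.
  rewrite kabc_spatialE.
  apply: le_trans (ler_normD _ _) _; apply: le_trans (lerD (ler_normD _ _) (lexx _)) _.
  by move: m1 m2 m3 l1 l2 l3 L1 L2 F1 F2 G1 G2 DF' DG' FQ; lra.
rewrite (is_derive1_derive1 (is_derive1_kabc_spatial x)).
apply: le_trans (ler_normD _ _) _.
apply: le_trans (lerD (le_trans (ler_normD _ _)
  (lerD (lexx _) (ler_normB _ _))) (lexx _)) _.
by move: m1 m2 m3 l1 l2 l3 L1 L2 F1 F2 G1 G2 DF' DG' FQ; lra.
Qed.

End fixed_profile.

End kabc_bounds.

(** * Propagation of exponential decay *)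

Section persistence.
Context {R : realType}.
Implicit Types (f g : R -> R) (a b c t x y z T theta : R).

(** The mean value theorem for [G + g] and [G - g]. *)
Lemma derive_comparison g dg G dG T : 0 <= T ->
  {within `[0, T], continuous g} ->
  (forall t, t \in `]0, T[ -> is_derive t 1 g (dg t)) ->
  (forall t, is_derive t 1 G (dG t)) ->
  (forall t, t \in `]0, T[ -> `|dg t| <= dG t) ->
  forall t, t \in `[0, T] -> `|g t - g 0| <= G t - G 0.
Proof.
move=> T0 cg dgE dGE dgG t; rewrite in_itv/= => /andP[t0 tT].
move: t0; rewrite le_eqVlt => /predU1P[<-|t0]; first by rewrite !subrr normr0.
have sub (s : R) : s \in `]0, t[ -> s \in `]0, T[.
  by rewrite !in_itv/= => /andP[-> /lt_le_trans]; apply.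
have cg' : {within `[0, t], continuous g}.
  by apply: continuous_subspaceW cg; apply: subset_itvl; rewrite bnd_simp.
have cG : {within `[0, t], continuous G}.
  by apply: continuous_subspaceT => s; exact: is_derive1_continuous (dGE s).
rewrite ler_norml; apply/andP; split.
  have [s sI] := @MVT R (fun s => G s + g s) (fun s => dG s + dg s) 0 t t0
    (fun s sI => is_derive1D (dGE s) (dgE s (sub s sI)))
    (fun s => cvgD (cG s) (cg' s)).
  have := dgG s (sub s sI); rewrite ler_norml => /andP[h _] E.
  have : 0 <= (dG s + dg s) * (t - 0) by apply: mulr_ge0; [lra|rewrite subr0 ltW].
  by rewrite -E; lra.
have [s sI] := @MVT R (fun s => G s - g s) (fun s => dG s - dg s) 0 t t0
    (fun s sI => is_derive1B (dGE s) (dgE s (sub s sI)))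
    (fun s => cvgB (cG s) (cg' s)).
have := dgG s (sub s sI); rewrite ler_norml => /andP[_ h] E.
have : 0 <= (dG s - dg s) * (t - 0) by apply: mulr_ge0; [lra|rewrite subr0 ltW].
by rewrite -E; lra.
Qed.

Lemma exp_decay_bounded theta f P : 0 < theta -> exp_decay theta f ->
  (forall x, `|f x| <= P) ->
  exists2 K, 0 <= K & forall x, `|f x| <= K * expR (- (theta * `|x|)).
Proof.
move=> t0 [L L0 [Ly LNy]] fP.
have P0 : 0 <= P by apply: le_trans (fP 0).
have [Ay [_ hAy]] : \forall x \near +oo, `|f x| / expR (- (theta * `|x|)) < L + 1.
  by apply: (cvgr_lt _ Ly); rewrite ltrDl.
have [ANy [_ hANy]] : \forall x \near -oo, `|f x| / expR (- (theta * `|x|)) < L + 1.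
  by apply: (cvgr_lt _ LNy); rewrite ltrDl.
pose A := Num.max `|Ay| `|ANy|.
exists (L + 1 + P * expR (theta * A)).
  by apply: addr_ge0; [lra|rewrite mulr_ge0// expR_ge0].
move=> x; rewrite -ler_pdivrMr ?expR_gt0//.
have e0 : 0 <= P * expR (theta * A) by rewrite mulr_ge0// expR_ge0.
have [xA|xA] := lerP `|x| A.
  have : `|f x| / expR (- (theta * `|x|)) <= P * expR (theta * A).
    rewrite expRN invrK ler_pM ?expR_ge0// ler_expR ler_wpM2l// ltW//.
  by move/le_trans; apply; rewrite lerDr; lra.
have : `|f x| / expR (- (theta * `|x|)) < L + 1; last by lra.
have [x0|x0] := ltP 0 x.
  apply: hAy; apply: le_lt_trans (ler_norm _) _.
  by move: xA; rewrite (gtr0_norm x0) /A gt_max => /andP[].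
apply: hANy; move: xA; rewrite (ler0_norm x0) /A gt_max => /andP[_].
by have := ler_norm (- ANy); rewrite normrN; lra.
Qed.

(** The perturbation decays at a faster rate, so it does not change the limit:
    the same [L] serves for all [t]. *)
Lemma exp_decay_uniform_perturbation (A : set R) theta theta' C (f0 : R -> R)
    (f : R -> R -> R) : theta < theta' -> 0 <= C -> exp_decay theta f0 ->
  (forall t x, A t -> `|f t x - f0 x| <= C * expR (- (theta' * `|x|))) ->
  exp_decay_uniform A theta f.
Proof.
move=> tt' C0 [L L0 [Ly LNy]] fC.
exists (fun=> L) => // eps eps0.
have e20 : 0 < eps / 2 by rewrite divr_gt0.
have [My [_ hMy]] := (cvgrPdist_lt _ _).1 Ly _ e20.
have [MNy [_ hMNy]] := (cvgrPdist_lt _ _).1 LNy _ e20.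
set del := theta' - theta; have del0 : 0 < del by rewrite subr_gt0.
pose M3 := 2 * C / (eps * del).
have M30 : 0 <= M3 by rewrite divr_ge0 ?mulr_ge0// ltW.
exists (Num.max (Num.max `|My| `|MNy|) M3) => t x At.
rewrite !gt_max => /andP[/andP[x1 x2] x3].
have x0 : 0 < `|x| by apply: le_lt_trans x3.
set e := expR (- (theta * `|x|)); have ep : 0 < e by exact: expR_gt0.
have h0 : `| `|f0 x| / e - L| < eps / 2.
  rewrite distrC; have [xp|xn] := ltP 0 x.
    apply: hMy; apply: le_lt_trans (ler_norm _) _.
    by move: x1; rewrite (gtr0_norm xp).
  apply: hMNy; move: x2; rewrite (ler0_norm xn).
  by have := ler_norm (- MNy); rewrite normrN; lra.
have h1 : `| `|f t x| / e - `|f0 x| / e| <= C * expR (- (del * `|x|)).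
  rewrite -mulrBl normrM (gtr0_norm (_ : 0 < e^-1)) ?invr_gt0// ler_pdivrMr//.
  have E : expR (- (del * `|x|)) * e = expR (- (theta' * `|x|)).
    by rewrite /e -expRD; congr expR; rewrite /del; ring.
  rewrite -mulrA E.
  exact: le_trans (ler_dist_dist _ _) (fC t x At).
have h2 : C * expR (- (del * `|x|)) < eps / 2.
  apply: (@le_lt_trans _ _ (C * (del * `|x|)^-1)).
    by rewrite ler_wpM2l// expRN_leV// mulr_gt0.
  rewrite ltr_pdivrMr ?mulr_gt0//.
  by move: x3; rewrite /M3 ltr_pdivrMr ?mulr_gt0//; lra.
rewrite (_ : _ - L = (`|f t x| / e - `|f0 x| / e) + (`|f0 x| / e - L)); last by ring.
by apply: le_lt_trans (ler_normD _ _) _; lra.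
Qed.

Section flow.
Variables (k : nat) (a b c T P theta : R) (u : R -> R -> R).
Hypotheses (hk : (2 <= k)%N) (T0 : 0 < T) (P1 : 1 <= P).
Hypotheses (theta0 : 0 < theta) (theta1 : theta < 1).
Hypothesis uC2 : forall t, t \in `[0, T] -> C2_bounded P (u t).
Hypothesis cu : forall x, {within `[0, T], continuous (fun t => u t x)}.
Hypothesis cux : forall x, {within `[0, T], continuous (fun t => derive1 (u t) x)}.
Hypothesis du : forall x t, t \in `]0, T[ ->
  is_derive t 1 (fun t => u t x) (- kabc_spatial k a b c (u t) x).
Hypothesis dux : forall x t, t \in `]0, T[ ->
  is_derive t 1 (fun t => derive1 (u t) x) (- derive1 (kabc_spatial k a b c (u t)) x).

Let q t x := `|u t x| + `|derive1 (u t) x|.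
Let Cst := kabc_const k a b c P.
Let Cst0 : 0 <= Cst. Proof. exact: kabc_const_ge0. Qed.
Let P0 : 0 < P. Proof. exact: lt_le_trans P1. Qed.
Let oo_cc t : t \in `]0, T[ -> t \in `[0, T].
Proof. by rewrite !in_itv/= => /andP[/ltW-> /ltW->]. Qed.
Let I0 : 0 \in `[0, T]. Proof. by rewrite in_itv/= lexx ltW. Qed.

Let q_bound t x : t \in `[0, T] -> q t x <= 2 * P.
Proof. by move=> tT; have [_ _ _ /(_ x)[]] := uC2 tT; rewrite /q; lra. Qed.

(** Gronwall's inequality in a weighted supremum norm.  Let S be the supremum of
    q / (expR (lam * t) * d) over the strip, with the weight
    d = expR (- (theta * `|x|)) + eps.  It is finite because [d >= eps].  The rate
    of change of [u] and [derive1 u] is at most C S expR (lam * t) d, since q^2 is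
    at most 2 P q; integrating in time gives S <= K0 + 2 C S / lam, and the choice
    of lam makes this S <= K0 + S / 2.  Neither lam nor the resulting bound
    depends on eps, so eps may tend to 0. *)
Lemma exp_weighted_bound K0 : 0 <= K0 ->
  (forall x, q 0 x <= K0 * expR (- (theta * `|x|))) ->
  exists2 K, 0 <= K & forall t x, t \in `[0, T] ->
    q t x <= K * expR (- (theta * `|x|)).
Proof.
move=> K00 qK0.
have t10 : 0 < 1 - theta by rewrite subr_gt0.
pose C := Cst * (2 * P) / (1 - theta).
have P20 : 0 <= 2 * P by have := P0; lra.
have C0 : 0 <= C.
  by apply: divr_ge0; [exact: mulr_ge0|exact: ltW].
pose lam := 4 * C + 1.
have lam0 : 0 < lam by rewrite /lam; lra.
exists (2 * K0 * expR (lam * T)); first by rewrite !mulr_ge0// expR_ge0.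
suff main eps : 0 < eps -> forall t x, t \in `[0, T] ->
    q t x <= 2 * K0 * expR (lam * T) * (expR (- (theta * `|x|)) + eps).
  move=> t x tT; apply/ler_addgt0Pr => e e0.
  have B0 : 0 < 2 * K0 * expR (lam * T) + 1.
    by rewrite ltr_wpDl// !mulr_ge0// expR_ge0.
  have := main _ (divr_gt0 e0 B0) t x tT => /le_trans; apply.
  rewrite mulrDr lerD2l mulrA ler_pdivrMr// mulrC ler_wpM2l ?(ltW e0)//.
  by rewrite lerDl.
move=> eps0.
pose d x := expR (- (theta * `|x|)) + eps.
have d0 x : 0 < d x by rewrite addr_gt0// expR_gt0.
pose E := [set z | exists t x, t \in `[0, T] /\ z = q t x / (expR (lam * t) * d x)].
have wgt0 t x : 0 < expR (lam * t) * d x by rewrite mulr_gt0// expR_gt0.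
have q0 t x : 0 <= q t x by rewrite addr_ge0.
have supE : has_sup E.
  split; first by exists (q 0 0 / (expR (lam * 0) * d 0)), 0, 0.
  exists (2 * P / eps) => z [t [x [tT ->]]].
  rewrite ler_pdivrMr// mulrAC ler_pdivlMr//.
  apply: ler_pM => //; [exact: ltW|exact: q_bound|].
  have : 1 <= expR (lam * t).
    rewrite -expR0 ler_expR mulr_ge0// ?(ltW lam0)//.
    by move: tT; rewrite in_itv/= => /andP[].
  move=> e1; rewrite -[leLHS]mul1r ler_pM// ?(ltW eps0)//.
  by rewrite /d lerDr expR_ge0.
set S := sup E.
have qS t x : t \in `[0, T] -> q t x <= S * (expR (lam * t) * d x).
  by move=> tT; rewrite -ler_pdivrMr//; apply: (sup_upper_bound supE); exists t, x.
have S0 : 0 <= S.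
  have := qS 0 0 I0; have := q0 0 0 => h1 h2.
  by move: (le_trans h1 h2); rewrite pmulr_lge0.
have rate t : t \in `]0, T[ -> forall x,
   `|kabc_spatial k a b c (u t) x| <= C * S * d x * expR (lam * t) /\
   `|derive1 (kabc_spatial k a b c (u t)) x| <= C * S * d x * expR (lam * t).
  move=> /oo_cc tT x.
  have K0' : 0 <= 2 * P * (S * expR (lam * t)) by rewrite !mulr_ge0 ?expR_ge0// ltW.
  have hq y : (`|u t y| + `|derive1 (u t) y|) ^+ 2 <=
      2 * P * (S * expR (lam * t)) * (expR (- (theta * `|y|)) + eps).
    rewrite -/(q t y) expr2 -mulrA; apply: ler_pM => //; first exact: q_bound.
    by rewrite -mulrA; exact: qS.
  have := kabc_spatial_le a b c hk P1 (uC2 tT) (ltW theta0) theta1 (ltW eps0) K0' hq x.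
  rewrite -/(d x) -/Cst (_ : _ * _ / _ * _ = C * S * d x * expR (lam * t))//.
  by rewrite /C; ring.
have dG x t : is_derive t 1 (fun t => C * S * d x / lam * expR (lam * t))
    (C * S * d x * expR (lam * t)).
  apply: (is_derive_eq (is_derive1Z _ (is_derive1_expR (is_derive1_lin lam t)))).
  by rewrite mulrCA [RHS]mulrC; congr (_ * _); rewrite divfK// gt_eqF.
have step t x : t \in `[0, T] ->
    q t x <= K0 * d x + S / 2 * (expR (lam * t) * d x).
  move=> tT.
  have h1 := derive_comparison (ltW T0) (@cu x) (fun t tT => du x tT) (dG x).
  have h2 := derive_comparison (ltW T0) (@cux x) (fun t tT => dux x tT) (dG x).
  have {}h1 := h1 _ t tT; have {}h2 := h2 _ t tT.
  have {}h1 : `|u t x - u 0 x| <=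
      C * S * d x / lam * expR (lam * t) - C * S * d x / lam * expR (lam * 0).
    by apply: h1 => s sT; rewrite normrN; have [] := rate s sT x.
  have {}h2 : `|derive1 (u t) x - derive1 (u 0) x| <=
      C * S * d x / lam * expR (lam * t) - C * S * d x / lam * expR (lam * 0).
    by apply: h2 => s sT; rewrite normrN; have [] := rate s sT x.
  have b1 : `|u t x| <= `|u 0 x| + `|u t x - u 0 x|.
    by rewrite -[in leLHS](subrK (u 0 x) (u t x)) addrC ler_normD.
  have b2 : `|derive1 (u t) x| <=
      `|derive1 (u 0) x| + `|derive1 (u t) x - derive1 (u 0) x|.
    rewrite -[in leLHS](subrK (derive1 (u 0) x) (derive1 (u t) x)) addrC.
    exact: ler_normD.
  have g0 : 0 <= C * S * d x / lam * expR (lam * 0).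
    rewrite mulr_ge0 ?expR_ge0// divr_ge0 ?(ltW lam0)//.
    by rewrite mulr_ge0 ?(ltW (d0 x))// mulr_ge0.
  have q0d : q 0 x <= K0 * d x.
    by apply: le_trans (qK0 x) _; rewrite ler_wpM2l// lerDl ltW.
  have gS : 2 * (C * S * d x / lam * expR (lam * t)) <= S / 2 * (expR (lam * t) * d x).
    have -> : 2 * (C * S * d x / lam * expR (lam * t)) =
              2 * C / lam * (S * (expR (lam * t) * d x)) by ring.
    have -> : S / 2 * (expR (lam * t) * d x) =
              2^-1 * (S * (expR (lam * t) * d x)) by ring.
    rewrite ler_wpM2r ?mulr_ge0//; first exact: ltW.
    by rewrite ler_pdivrMr// /lam; lra.
  move: q0d; rewrite /q; lra.
have SK : S <= K0 + S / 2.
  apply: ge_sup; first by case: supE.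
  move=> z [t [x [tT ->]]]; rewrite ler_pdivrMr// mulrDl.
  apply: le_trans (step t x tT) _; rewrite lerD2r.
  rewrite ler_wpM2l// ler_peMl// ?(ltW (d0 x))//.
  rewrite -expR0 ler_expR mulr_ge0// ?(ltW lam0)//.
  by move: tT; rewrite in_itv/= => /andP[].
move=> t x tT; apply: le_trans (qS t x tT) _.
rewrite mulrA -/(d x) ler_wpM2r ?(ltW (d0 x))//.
rewrite ler_pM ?expR_ge0//; first by lra.
by rewrite ler_expR ler_wpM2l ?(ltW lam0)//; move: tT; rewrite in_itv/= => /andP[].
Qed.

(** By [exp_weighted_bound] the square of [`|u| + `|derive1 u|] decays at the rate
    2 theta, and therefore the time derivatives decay at every rate below 1 that
    does not exceed 2 theta.  Such a rate th can exceed theta, so the solution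
    differs from the initial datum by a term of lower order at infinity. *)
Theorem kabc_persistence : exp_decay theta (u 0) -> exp_decay theta (derive1 (u 0)) ->
  exp_decay_uniform [set` `[0, T]] theta u /\
  exp_decay_uniform [set` `[0, T]] theta (fun t => derive1 (u t)).
Proof.
move=> dec dec'.
have [_ _ _ b0] := uC2 I0.
have [K1 K10 hK1] := @exp_decay_bounded _ _ P theta0 dec
  (fun x => let: And3 h _ _ := b0 x in h).
have [K2 K20 hK2] := @exp_decay_bounded _ _ P theta0 dec'
  (fun x => let: And3 _ h _ := b0 x in h).
have [|x|K K0 hK] := @exp_weighted_bound (K1 + K2).
- by rewrite addr_ge0.
- by rewrite mulrDl lerD.
pose th := Num.min (2 * theta) ((1 + theta) / 2).
have t0 := theta0; have t1 := theta1.
have th_gt : theta < th by rewrite lt_min; apply/andP; split; lra.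
have th_lt1 : th < 1 by rewrite gt_min; apply/orP; right; lra.
have th_le2 : th <= 2 * theta by rewrite ge_min lexx.
have th0 : 0 <= th by apply: ltW; apply: lt_trans th_gt.
have K20' : 0 <= K ^+ 2 by rewrite sqr_ge0.
pose C := Cst * K ^+ 2 / (1 - th).
have C0 : 0 <= C.
  by apply: divr_ge0; [exact: mulr_ge0|rewrite subr_ge0 ltW].
have rate t : t \in `]0, T[ -> forall x,
   `|kabc_spatial k a b c (u t) x| <= C * expR (- (th * `|x|)) /\
   `|derive1 (kabc_spatial k a b c (u t)) x| <= C * expR (- (th * `|x|)).
  move=> /oo_cc tT x.
  have hq y : (`|u t y| + `|derive1 (u t) y|) ^+ 2 <=
      K ^+ 2 * (expR (- (th * `|y|)) + 0).
    rewrite addr0; apply: (@le_trans _ _ ((K * expR (- (theta * `|y|))) ^+ 2)).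
      by rewrite lerXn2r ?nnegrE ?addr_ge0// ?mulr_ge0 ?expR_ge0//; exact: hK.
    rewrite exprMn ler_wpM2l// -expRM_natl ler_expR.
    by rewrite mulrN lerN2 mulrA ler_wpM2r.
  have := kabc_spatial_le a b c hk P1 (uC2 tT) th0 th_lt1 (lexx 0) K20' hq x.
  by rewrite addr0.
have dG x t : is_derive t 1 (fun t => C * expR (- (th * `|x|)) * t)
    (C * expR (- (th * `|x|))).
  exact: is_derive1_lin.
have fin t x : t \in `[0, T] ->
    C * expR (- (th * `|x|)) * t - C * expR (- (th * `|x|)) * 0 <=
    C * T * expR (- (th * `|x|)).
  rewrite mulr0 subr0 in_itv/= => /andP[_ tT].
  by rewrite [C * T * _]mulrAC ler_wpM2l// mulr_ge0// expR_ge0.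
have CT0 : 0 <= C * T by rewrite mulr_ge0// ltW.
split.
  apply: (exp_decay_uniform_perturbation th_gt CT0 dec) => t x tT.
  apply: le_trans (fin t x tT).
  apply: (derive_comparison (ltW T0) (@cu x) (fun t tT => du x tT) (dG x)) => //.
  by move=> s sT; rewrite normrN; have [] := rate s sT x.
apply: (exp_decay_uniform_perturbation th_gt CT0 dec') => t x tT.
apply: le_trans (fin t x tT).
apply: (derive_comparison (ltW T0) (@cux x) (fun t tT => dux x tT) (dG x)) => //.
by move=> s sT; rewrite normrN; have [] := rate s sT x.
Qed.

End flow.

End persistence.

(** * Linearity of the Fourier transform *)

Section fourier_linearity.
Context {R : realType}.
Local Notation mu := (@lebesgue_measure R).
Local Notation integr f := (mu.-integrable setT (EFin \o f)).
Implicit Types (f g phi : R -> R) (r s x y z : R) (h k : (R -> R) * (R -> R)).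

Lemma integr_L2_mul f g : f \in Lfun mu 2%:E -> measurable_fun setT g ->
  integr (fun x => g x ^+ 2) -> integr (fun x => f x * g x).
Proof.
move=> f2 mg g2; have if2 := Lfun2_integrable_sqr f2.
apply: integrable_dominated (integrD if2 g2) _.
  by apply: measurable_funM => //; exact: L2_measurable.
move=> x; rewrite normrM -(real_normK (num_real (f x))) -(real_normK (num_real (g x))).
have := sqr_ge0 (`|f x| - `|g x|).
by have := sqr_ge0 `|f x|; have := sqr_ge0 `|g x|; nra.
Qed.

Lemma integr_bracketV : integr (fun x : R => (1 + x ^+ 2)^-1).
Proof.
have := @integr_bracket_powR R 1 ltac:(lra).
by under eq_fun do rewrite powR_inv1 ?addr_ge0 ?sqr_ge0//.
Qed.

Lemma integr_bracketM_bounded g C : measurable_fun setT g ->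
  (forall x, (1 + x ^+ 2) * `|g x| <= C) -> integr g.
Proof.
move=> mg gC; apply: (integrable_dominated mg (integrZ C integr_bracketV)) => x.
by rewrite ler_pdivlMr ?ltr_pwDl ?sqr_ge0// mulrC.
Qed.

Lemma schwartz_continuous phi n : schwartz phi -> continuous (derive1n n phi).
Proof.
move=> [d _] x; exact: is_derive1_continuous (derivable_is_derive1 (d n x)).
Qed.

Lemma schwartz_decay phi n : schwartz phi ->
  exists C, forall x, (1 + x ^+ 2) * `|derive1n n phi x| <= C.
Proof.
move=> [_ b]; have [C0 h0] := b 0%N n; have [C2 h2] := b 2%N n.
exists (C0 + C2) => x; rewrite mulrDl mul1r; apply: lerD.
  by have := h0 x; rewrite expr0 mul1r.
by have := h2 x; rewrite normrM [`|x ^+ 2|]ger0_norm ?sqr_ge0.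
Qed.

Lemma schwartz_integr phi n : schwartz phi -> integr (derive1n n phi).
Proof.
move=> sp; have [C hC] := schwartz_decay n sp.
apply: integr_bracketM_bounded hC.
exact: continuous_measurable_fun (@schwartz_continuous _ n sp).
Qed.

Lemma schwartz_sqr_integr phi : schwartz phi -> integr (fun x => phi x ^+ 2).
Proof.
move=> sp; have [C hC] := schwartz_decay 0 sp.
have := @integrM_bounded _ _ phi C (@schwartz_integr phi 0 sp)
  (continuous_measurable_fun (@schwartz_continuous phi 0 sp)).
under eq_fun do rewrite -expr2.
apply => x; apply: le_trans (hC x).
by rewrite ler_peMl//= lerDl sqr_ge0.
Qed.

Lemma cos_transformE phi x : cos_transform phi x = inv_fourier (phi, fun=> 0) x.
Proof. by apply: eq_Rintegral => xi _; rewrite /= mul0r subr0. Qed.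

Lemma continuous_cos_transform phi : schwartz phi -> continuous (cos_transform phi).
Proof.
move=> sp; have -> : cos_transform phi = inv_fourier (phi, fun=> 0).
  by apply/funext => x; exact: cos_transformE.
apply: continuous_inv_fourier; first exact: (@schwartz_integr phi 0 sp).
exact: integrable0.
Qed.

Lemma continuous_sin_transform phi : schwartz phi -> continuous (sin_transform phi).
Proof.
move=> sp; have -> : sin_transform phi = inv_fourier (fun=> 0, (fun x => - phi x)).
  apply/funext => x; apply: eq_Rintegral => xi _.
  by rewrite /= mul0r sub0r mulNr opprK.
apply: continuous_inv_fourier; first exact: integrable0.
exact: integrN (@schwartz_integr phi 0 sp).
Qed.

Lemma schwartz_mul_bounded_cvg0 phi (t : R -> R) : schwartz phi ->
  (forall x, `|t x| <= 1) ->
  (fun x => phi x * t x) x @[x --> +oo] --> 0 /\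
  (fun x => phi x * t x) x @[x --> -oo] --> 0.
Proof.
move=> [_ b] t1; have [C hC] := b 1%N 0%N.
apply: (@cvg0_pinfty_ninfty _ _ C) => x; apply: le_trans (hC x).
by rewrite !normrM expr1 ler_wpM2l// ler_piMr.
Qed.

Lemma schwartz_by_parts phi (t dt : R -> R) x : schwartz phi ->
  (forall xi : R, is_derive xi 1 t (x * dt xi)) -> continuous dt ->
  (forall xi, `|t xi| <= 1) -> (forall xi, `|dt xi| <= 1) ->
  x * \int[mu]_xi (phi xi * dt xi) = - \int[mu]_xi (derive1 phi xi * t xi).
Proof.
move=> sp dt_t cdt t1 dt1.
have i0 := @schwartz_integr phi 0 sp; have i1 := @schwartz_integr phi 1 sp.
have c0 := @schwartz_continuous phi 0 sp; have c1 := @schwartz_continuous phi 1 sp.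
have ct : continuous t by move=> xi; exact: is_derive1_continuous (dt_t xi).
have j0 := integrM_bounded i0 (continuous_measurable_fun cdt) dt1.
have j1 := integrM_bounded i1 (continuous_measurable_fun ct) t1.
have dF (xi : R) : is_derive xi 1 (fun xi => phi xi * t xi)
    (derive1 phi xi * t xi + x * (phi xi * dt xi)).
  have dp : is_derive xi 1 phi (derive1 phi xi).
    by apply: derivable_is_derive1; exact: (sp.1 0%N xi).
  by apply: (is_derive_eq (is_derive1M dp (dt_t xi))); ring.
have [g0 Ng0] := schwartz_mul_bounded_cvg0 sp t1.
have cg : continuous (fun xi => derive1 phi xi * t xi + x * (phi xi * dt xi)).
  move=> xi; apply: cvgD; [apply: cvgM|apply: cvgMr; apply: cvgM].
  - exact: c1.
  - exact: ct.
  - exact: c0.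
  - exact: cdt.
have := Rintegral_derive_eq0 dF cg (integrD j1 (integrZ x j0)) g0 Ng0.
rewrite RintegralD//; last exact: integrZ.
by rewrite RintegralZl// => /eqP; rewrite addrC addr_eq0 => /eqP.
Qed.

Lemma Rintegral_mul_bounded phi (t : R -> R) : integr phi -> measurable_fun setT t ->
  (forall xi, `|t xi| <= 1) -> `|\int[mu]_xi (phi xi * t xi)| <= \int[mu]_xi `|phi xi|.
Proof.
move=> ip mt t1; apply: le_normr_Rintegral_dominated; last first.
- by move=> xi; rewrite normrM ler_piMr.
- exact: integr_norm.
- by apply: measurable_funM => //; exact: integr_measurable.
Qed.

(** [(1 + x ^+ 2) * F x ^+ 2 <= 2 * C ^+ 2]. *)
Lemma transform_sqr_integr (F : R -> R) C : continuous F ->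
  (forall x, `|F x| <= C) -> (forall x, `|x * F x| <= C) ->
  integr (fun x => F x ^+ 2).
Proof.
move=> cF FC xFC.
apply: (@integr_bracketM_bounded _ (C ^+ 2 + C ^+ 2)).
  by apply: measurable_funX; exact: continuous_measurable_fun.
move=> x; rewrite mulrDl mul1r ger0_norm ?sqr_ge0// -exprMn.
rewrite -(real_normK (num_real (F x))) -(real_normK (num_real (x * F x))).
have C0 : 0 <= C by apply: le_trans (FC 0).
by apply: lerD; rewrite lerXn2r ?nnegrE.
Qed.

(** One integration by parts gives the decay of order 1 / x. *)
Lemma cos_transform_sqr_integr phi : schwartz phi ->
  integr (fun x => cos_transform phi x ^+ 2).
Proof.
move=> sp; have i0 := @schwartz_integr phi 0 sp; have i1 := @schwartz_integr phi 1 sp.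
have t1 x xi : `|sin (xi * x : R)| <= 1 by rewrite ler_norml sin_geN1 sin_le1.
have t2 x xi : `|cos (xi * x : R)| <= 1 by rewrite ler_norml cos_geN1 cos_le1.
apply: (@transform_sqr_integr _
  (Num.max (\int[mu]_xi `|phi xi|) (\int[mu]_xi `|derive1 phi xi|))).
- exact: continuous_cos_transform.
- move=> x; rewrite le_max Rintegral_mul_bounded//.
  exact: measurable_cos_lin.
- move=> x; rewrite /cos_transform.
  have -> : x * \int[mu]_xi (phi xi * cos (xi * x)) =
            - \int[mu]_xi (derive1 phi xi * sin (xi * x)).
    apply: schwartz_by_parts => //; last exact: continuous_mul_lin (@continuous_cos R).
    move=> xi; apply: (is_derive_eq (is_derive1_sin
      (is_derive1M (is_derive1_id xi) (is_derive1_cst x xi)))).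
    by ring.
  rewrite normrN le_max orbC Rintegral_mul_bounded//.
  exact: measurable_sin_lin.
Qed.

Lemma sin_transform_sqr_integr phi : schwartz phi ->
  integr (fun x => sin_transform phi x ^+ 2).
Proof.
move=> sp; have i0 := @schwartz_integr phi 0 sp; have i1 := @schwartz_integr phi 1 sp.
have t1 x xi : `|sin (xi * x : R)| <= 1 by rewrite ler_norml sin_geN1 sin_le1.
have t2 x xi : `|cos (xi * x : R)| <= 1 by rewrite ler_norml cos_geN1 cos_le1.
apply: (@transform_sqr_integr _
  (Num.max (\int[mu]_xi `|phi xi|) (\int[mu]_xi `|derive1 phi xi|))).
- exact: continuous_sin_transform.
- move=> x; rewrite le_max Rintegral_mul_bounded//.
  exact: measurable_sin_lin.
- move=> x; rewrite /sin_transform.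
  have -> : x * \int[mu]_xi (phi xi * sin (xi * x)) =
            - \int[mu]_xi (derive1 phi xi * - cos (xi * x)).
    apply: schwartz_by_parts => //; last 2 first.
    + exact: continuous_mul_lin (@continuous_sin R).
    + by move=> xi; rewrite normrN.
    move=> xi; apply: (is_derive_eq (is_derive1N (is_derive1_cos
      (is_derive1M (is_derive1_id xi) (is_derive1_cst x xi))))).
    by ring.
  rewrite normrN le_max orbC Rintegral_mul_bounded//.
    by apply: measurableT_comp => //; exact: measurable_cos_lin.
  by move=> xi; rewrite normrN.
Qed.

(** The integral is additive on integrable functions only, so linearity needs
    the transforms of Schwartz functions to be square integrable. *)
Lemma fourier_of_lincomb f g h k r s : fourier_of f h -> fourier_of g k ->
  fourier_of (fun x => r * f x + s * g x)
    ((fun xi => r * h.1 xi + s * k.1 xi), (fun xi => r * h.2 xi + s * k.2 xi)).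
Proof.
move=> [f2 h12 h22 fh] [g2 k12 k22 gk].
have L (u v : R -> R) : u \in Lfun mu 2%:E -> v \in Lfun mu 2%:E ->
    (fun x => r * u x + s * v x) \in Lfun mu 2%:E.
  have le12 : (1 <= 2%:E :> \bar R)%E by rewrite lee1n.
  have Z (q : R) (w : R -> R) :
      w \in Lfun mu 2%:E -> (fun x => q * w x) \in Lfun mu 2%:E.
    move=> lw; have -> : (fun x => q * w x) = q \o* w.
      by apply/funext => x; rewrite /= mulrC.
    by apply: Lfun_scale => //; rewrite ler1n.
  by move=> l1 l2; apply: (Lfun_addr_closed mu le12).2; exact: Z.
have I (u v p : R -> R) : u \in Lfun mu 2%:E -> v \in Lfun mu 2%:E ->
    measurable_fun setT p -> integr (fun x => p x ^+ 2) ->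
    \int[mu]_x ((r * u x + s * v x) * p x) =
    r * \int[mu]_x (u x * p x) + s * \int[mu]_x (v x * p x).
  move=> l1 l2 mp p2.
  have j1 := integr_L2_mul l1 mp p2; have j2 := integr_L2_mul l2 mp p2.
  rewrite -!RintegralZl// -RintegralD//; try exact: integrZ.
  by apply: eq_Rintegral => x _; ring.
split; [exact: L|exact: L|exact: L|].
move=> phi sp.
have mp : measurable_fun setT phi.
  exact: continuous_measurable_fun (@schwartz_continuous phi 0 sp).
have p2 := schwartz_sqr_integr sp.
have [F1 F2] := fh _ sp; have [G1 G2] := gk _ sp.
have mc := continuous_measurable_fun (continuous_cos_transform sp).
have ms := continuous_measurable_fun (continuous_sin_transform sp).
have c2 := cos_transform_sqr_integr sp; have s2 := sin_transform_sqr_integr sp.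
rewrite (I _ _ _ h12 k12 mp p2) (I _ _ _ h22 k22 mp p2).
rewrite (I _ _ _ f2 g2 mc c2) (I _ _ _ f2 g2 ms s2).
by rewrite F1 F2 G1 G2; split => //; ring.
Qed.

Lemma fourier_of_ae_eq f g h : measurable_fun setT g -> fourier_of f h ->
  {ae mu, forall x, f x = g x} -> fourier_of g h.
Proof.
move=> mg [f2 h12 h22 fh] fg.
have mf := L2_measurable f2.
have I (p : R -> R) : measurable_fun setT p ->
    \int[mu]_x (g x * p x) = \int[mu]_x (f x * p x).
  move=> mp; congr fine; apply: ae_eq_integral => //.
  - by apply/measurable_EFinP; exact: measurable_funM.
  - by apply/measurable_EFinP; exact: measurable_funM.
  - move: fg; apply: filterS; first exact: (ae_filter_ringOfSetsType mu).
    by move=> x fgx _; rewrite fgx.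
split => //; last first.
  move=> phi sp; have [F1 F2] := fh _ sp.
  rewrite !I//; first exact: continuous_measurable_fun (continuous_sin_transform sp).
  exact: continuous_measurable_fun (continuous_cos_transform sp).
rewrite inE; apply/andP; split; first by rewrite inE.
rewrite inE /= /finite_norm.
suff -> : Lnorm mu 2%:E (EFin \o g) = Lnorm mu 2%:E (EFin \o f).
  by move: f2; rewrite inE => /andP[_]; rewrite inE.
rewrite unlock; congr (_ `^ _)%E; apply: ae_eq_integral.
- exact: measurableT.
- apply/measurable_EFinP.
  apply: (@measurableT_comp _ _ _ _ _ _ (fun x : R => x `^ 2)) => //.
  exact: measurableT_comp.
- apply/measurable_EFinP.
  apply: (@measurableT_comp _ _ _ _ _ _ (fun x : R => x `^ 2)) => //.
  exact: measurableT_comp.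
- move: fg; apply: filterS; first exact: (ae_filter_ringOfSetsType mu).
  by move=> x fgx _ /=; rewrite fgx.
Qed.

End fourier_linearity.

(** * Classical regularity of strong solutions *)

Section time_regularity.
Context {R : realType}.
Local Notation mu := (@lebesgue_measure R).
Implicit Types (f g : R -> R) (s t x y e : R).

Lemma is_derive1_eps f x l :
  (forall e, 0 < e -> exists2 d, 0 < d & forall y, `|y - x| < d -> y != x ->
     `|(f y - f x) / (y - x) - l| <= e) ->
  is_derive x 1 f l.
Proof.
move=> H.
have cv : h^-1 *: ((f \o shift x) (h *: (1 : R)) - f x) @[h --> 0^'] --> l.
  apply/cvgrPdist_le => e e0; have [d d0 hd] := H e e0.
  near=> h.
  have h0 : h != 0 by near: h; exact: nbhs_dnbhs_neq.
  have hd' : `|h| < d by near: h; exact: dnbhs0_lt.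
  have := hd (h + x); rewrite addrK => /(_ hd').
  rewrite -subr_eq0 addrK => /(_ h0); rewrite distrC /= scaler1.
  by rewrite /GRing.scale/= mulrC.
have df : derivable f x 1 by apply/cvg_ex; exists l.
by apply: DeriveDef => //; exact: cvg_lim cv.
Unshelve. all: end_near. Qed.

Lemma near_ereal0_lt (I : Type) (F : set_system I) (N : I -> \bar R) e :
  Filter F -> N t @[t --> F] --> 0%E -> 0 < e -> \forall t \near F, (N t < e%:E)%E.
Proof.
move=> FF /fine_cvgP[Nfin N0] e0.
have N1 := cvgr_lt _ N0 e e0.
near=> t.
have h1 : N t \is a fin_num by near: t; exact: Nfin.
have h2 : fine (N t) < e by near: t; exact: N1.
by rewrite -(fineK h1) lte_fin.
Unshelve. all: end_near. Qed.

Lemma fourierP f : (exists h, fourier_of f h) -> fourier_of f (fourier f).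
Proof. exact: getPex. Qed.

Lemma Hs_norm_ge0 s f : (0 <= Hs_norm s f)%E.
Proof. exact: Lnorm_ge0. Qed.

Lemma fine_Hs_norm_lt s f e : (Hs_norm s f < e%:E)%E ->
  (Hs_norm s f < +oo)%E /\ fine (Hs_norm s f) <= e.
Proof.
move=> h; have fin : (Hs_norm s f < +oo)%E by apply: lt_trans h (ltry _).
split => //; rewrite -lee_fin fineK; first exact: ltW.
by rewrite ge0_fin_numE ?Hs_norm_ge0.
Qed.

Definition C2_close e f g := forall x,
  [/\ `|f x - g x| <= e, `|derive1 f x - derive1 g x| <= e &
      `|derive1n 2 f x - derive1n 2 g x| <= e].

Section solution.
Variables (k : nat) (a b c T s : R) (u : R -> R -> R).
Hypotheses (hk : (2 <= k)%N) (T0 : 0 < T) (s52 : 5 / 2 < s).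
Hypothesis hu : kabc_strong_solution k a b c s T u.

Let uHs : C_Hs s T u. Proof. by case: hu. Qed.
Let cont_u t : t \in `[0, T] -> continuous (u t).
Proof. by case: hu => _ h _; exact: h. Qed.

Let u_fourier t : t \in `[0, T] -> fourier_of (u t) (fourier (u t)).
Proof. by move=> tT; apply: fourierP; have [] := uHs.1 t tT. Qed.

(* The embedding applies to differences only once their transforms exist. *)
Let diff_fourier t0 t r : t0 \in `[0, T] -> t \in `[0, T] ->
  exists h, fourier_of (fun x => r * (u t x - u t0 x)) h.
Proof.
move=> t0T tT; have := fourier_of_lincomb r (- r) (u_fourier tT) (u_fourier t0T).
set h := (X in fourier_of _ X); exists h.
suff -> : (fun x => r * (u t x - u t0 x)) = (fun x => r * u t x + - r * u t0 x) by [].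
by apply/funext => x; ring.
Qed.

Let s2 : 2%:R + 2^-1 < s. Proof. by have := s52; lra. Qed.

Let slice_C2 t : t \in `[0, T] -> exists P, C2_bounded P (u t).
Proof.
move=> tT; have [C C0 emb] := sobolev_embedding s2.
have [_ hN] := uHs.1 t tT.
have E := emb (u t) _ (cont_u tT) (u_fourier tT) hN.
have [d0 _ b0] := E 0%N isT; have [d1 _ b1] := E 1%N isT; have [_ c2 b2] := E 2%N isT.
exists (C * fine (hs_norm s (fourier (u t)))); split.
- exact: d0.
- exact: d1.
- exact: c2.
- by move=> x; split; [exact: b0|exact: b1|exact: b2].
Qed.

Let slice_diff : exists2 C, 0 <= C & forall t0 t e, t0 \in `[0, T] -> t \in `[0, T] ->
  (Hs_norm s (fun x => u t x - u t0 x)%R < e%:E)%E ->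
  C2_close (C * e) (u t) (u t0).
Proof.
have [C C0 emb] := sobolev_embedding s2.
exists C => // t0 t e t0T tT /fine_Hs_norm_lt[fin le_e] x.
have [P [d0 d1 _ _]] := slice_C2 t0T; have [Q [e0 e1 _ _]] := slice_C2 tT.
set D := (fun x => u t x - u t0 x).
have cD : continuous D.
  by move=> y; apply: cvgB; [exact: (cont_u tT)|exact: (cont_u t0T)].
have fD : fourier_of D (fourier D).
  apply: fourierP; have [h hh] := diff_fourier 1 t0T tT; exists h.
  suff -> : D = (fun x => 1 * (u t x - u t0 x)) by [].
  by apply/funext => y; rewrite mul1r.
have E := emb D _ cD fD fin.
have D1 : derive1 D = (fun x => derive1 (u t) x - derive1 (u t0) x).
  by apply/funext => y; apply: is_derive1_derive1; apply: is_derive1B;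
    exact: derivable_is_derive1.
have D2 : derive1n 2 D = (fun x => derive1n 2 (u t) x - derive1n 2 (u t0) x).
  rewrite derive1nS derive1n1 D1.
  by apply/funext => y; apply: is_derive1_derive1; apply: is_derive1B;
    exact: derivable_is_derive1.
have up z : z <= C * fine (hs_norm s (fourier D)) -> z <= C * e.
  by move/le_trans; apply; rewrite ler_wpM2l.
have [_ _ b0] := E 0%N isT; have [_ _ b1] := E 1%N isT; have [_ _ b2] := E 2%N isT.
split; apply: up; first exact: (b0 x).
- by have := b1 x; rewrite derive1n1 D1.
- by have := b2 x; rewrite D2.
Qed.

Let time_cont t0 e : t0 \in `[0, T] -> 0 < e ->
  \forall t \near nbhs t0, t \in `[0, T] -> C2_close e (u t) (u t0).
Proof.
move=> t0T e0; have [C C0 hC] := slice_diff.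
have C10 : 0 < C + 1 by rewrite ltr_wpDl.
have := near_ereal0_lt _ (uHs.2 t0 t0T) (divr_gt0 e0 C10).
rewrite near_withinE => nr; near=> t => tT x.
have h : (Hs_norm s (fun x => u t x - u t0 x)%R < (e / (C + 1))%:E)%E.
  by move: tT; near: t; exact: nr.
have [h0 h1 h2] := hC t0 t _ t0T tT h x.
have le_e : C * (e / (C + 1)) <= e.
  by rewrite mulrA ler_pdivrMr// mulrC ler_wpM2l ?(ltW e0)// lerDl.
by split; apply: le_trans le_e.
Unshelve. all: end_near. Qed.

(** Near each time the slices are uniformly close in C^2, and [0, T] is
    compact. *)
Lemma slices_C2_bounded :
  exists2 P, 1 <= P & forall t, t \in `[0, T] -> C2_bounded P (u t).
Proof.
have cover : \forall P \near +oo, `[0, T]%classic `<=`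
    [set t | t \in `[0, T] -> C2_bounded P (u t)].
  apply: ((compact_near_coveringP _).1 (@segment_compact R 0 T) R (pinfty_nbhs R)
    (fun P t => t \in `[0, T] -> C2_bounded P (u t))) => t0 t0T.
  have [M [d0 d1 c2 b0]] := slice_C2 t0T.
  have nt := time_cont t0T ltr01.
  exists ([set t | t \in `[0, T] -> C2_close 1 (u t) (u t0)],
    [set P | M + 1 < P]) => /=.
    by split => //; apply: nbhs_pinfty_gt; exact: num_real.
  move=> [t P] /= [h MP] tT; have [Q [e0 e1 ce2 _]] := slice_C2 tT.
  have tri (y z : R) : `|y - z| <= 1 -> `|z| <= M -> `|y| <= P.
    by rewrite !ler_norml => /andP[? ?] /andP[? ?]; apply/andP; split; lra.
  split => // x; have [h0 h1 h2] := h tT x; have [m0 m1 m2] := b0 x.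
  by split; [exact: tri h0 m0|exact: tri h1 m1|exact: tri h2 m2].
have one : \forall P \near +oo, 1 < P :> R by apply: nbhs_pinfty_gt; exact: num_real.
have [P [P1 hP]] : exists P : R, 1 < P /\ `[0, T]%classic `<=`
    [set t | t \in `[0, T] -> C2_bounded P (u t)].
  near (pinfty_nbhs R) => P; exists P; split; first by near: P; exact: one.
  by near: P; exact: cover.
by exists P; [exact: ltW|move=> t tT; exact: hP].
Unshelve. all: end_near. Qed.

Lemma slice_time_continuous x :
  {within `[0, T], continuous (fun t => u t x)} /\
  {within `[0, T], continuous (fun t => derive1 (u t) x)}.
Proof.
split; apply/subspace_continuousP => t0 t0T; apply/cvgrPdist_le => e e0;
  have nr := time_cont t0T e0; rewrite near_withinE; near=> t => tT;
  rewrite distrC; suff /(_ x)[] : C2_close e (u t) (u t0) by [].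
- by apply: (_ : t \in `[0, T] -> _) tT; near: t; exact: nr.
- by apply: (_ : t \in `[0, T] -> _) tT; near: t; exact: nr.
Unshelve. all: end_near. Qed.

(** The difference quotients converge in H^(s - 1), and [3 / 2 < s - 1], so their
    continuous representatives converge in C^1.  By the equation the limit has
    the continuous representative [- kabc_spatial k a b c (u t0)]. *)
Lemma slice_time_derivative t0 x : t0 \in `]0, T[ ->
  is_derive t0 1 (fun t => u t x) (- kabc_spatial k a b c (u t0) x) /\
  is_derive t0 1 (fun t => derive1 (u t) x)
    (- derive1 (kabc_spatial k a b c (u t0)) x).
Proof.
move=> t0I; have t0T : t0 \in `[0, T].
  by move: t0I; rewrite !in_itv/= => /andP[/ltW-> /ltW->].
have [P P1 uC2] := slices_C2_bounded.
have [_ _ [ut [utHs utD utE]]] := hu.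
set w := kabc_spatial k a b c (u t0).
have dw y : is_derive y 1 w (derive1 w y).
  have d := is_derive1_kabc_spatial k a b c (uC2 t0 t0T) y.
  by rewrite (is_derive1_derive1 d).
have cw : continuous w by move=> y; exact: is_derive1_continuous (dw y).
have s1 : 1%:R + 2^-1 < s - 1 by have := s52; lra.
have [C C0 emb] := sobolev_embedding s1.
have C10 : 0 < C + 1 by rewrite ltr_wpDl.
have main e : 0 < e -> \forall t \near nbhs t0, t != t0 ->
    `|(u t x - u t0 x) / (t - t0) - - w x| <= e /\
    `|(derive1 (u t) x - derive1 (u t0) x) / (t - t0) - - derive1 w x| <= e.
  move=> e0.
  have := near_ereal0_lt _ (utD t0 t0T) (divr_gt0 e0 C10).
  rewrite near_withinE /dnbhs near_withinE => nr.
  have inT : \forall t \near nbhs t0, t \in `[0, T].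
    have near_oo : \forall t \near nbhs t0, t \in `]0, T[ by exact: near_in_itvoo.
    near=> t; have : t \in `]0, T[ by near: t; exact: near_oo.
    by rewrite !in_itv/= => /andP[/ltW-> /ltW->].
  near=> t => tt0.
  have tT : t \in `[0, T] by near: t.
  have : (Hs_norm (s - 1) (fun x => (u t x - u t0 x) / (t - t0) - ut t0 x)%R <
      (e / (C + 1))%:E)%E.
    by move: tT; apply: (_ : t != t0 -> _) tt0; near: t; exact: nr.
  move=> /fine_Hs_norm_lt[fin le_e].
  set q := (fun x => (u t x - u t0 x) / (t - t0) - ut t0 x) in fin le_e.
  (* the continuous representative of q, in which ut t0 is replaced by - w *)
  pose q' x := (t - t0)^-1 * (u t x - u t0 x) + w x.
  have cq : continuous q'.
    move=> y; apply: cvgD; last exact: cw.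
    by apply: cvgMr; apply: cvgB; [exact: (cont_u tT)|exact: (cont_u t0T)].
  have fq : fourier_of q (fourier q).
    apply: fourierP; have [h hh] := diff_fourier (t - t0)^-1 t0T tT.
    have uth : fourier_of (ut t0) (fourier (ut t0)).
      by apply: fourierP; have [] := utHs.1 t0 t0T.
    have := fourier_of_lincomb 1 (-1) hh uth.
    set h' := (X in fourier_of _ X); exists h'.
    suff -> : q = (fun x => 1 * ((t - t0)^-1 * (u t x - u t0 x)) + -1 * ut t0 x) by [].
    by apply/funext => y; rewrite /q; ring.
  have fq' : fourier_of q' (fourier q).
    apply: fourier_of_ae_eq (continuous_measurable_fun cq) fq _.
    have := utE t0 t0T; apply: filterS; first exact: (ae_filter_ringOfSetsType mu).
    move=> y; rewrite -/(w y) => E; rewrite /q /q'.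
    have -> : w y = - ut t0 y by apply/eqP; rewrite -addr_eq0 addrC E.
    by ring.
  have E := emb q' _ cq fq' fin.
  have up z : z <= C * fine (hs_norm (s - 1) (fourier q)) -> z <= e.
    move/le_trans; apply; apply: (@le_trans _ _ (C * (e / (C + 1)))).
      by rewrite ler_wpM2l.
    by rewrite mulrA ler_pdivrMr// mulrC ler_wpM2l ?(ltW e0)// lerDl.
  have D1 : derive1 q' x =
      (t - t0)^-1 * (derive1 (u t) x - derive1 (u t0) x) + derive1 w x.
    have [d0 _ _ _] := uC2 _ t0T; have [e0' _ _ _] := uC2 _ tT.
    apply: is_derive1_derive1; apply: is_derive1D => //; apply: is_derive1Z.
    by apply: is_derive1B; exact: derivable_is_derive1.
  have [_ _ b0] := E 0%N isT; have [_ _ b1] := E 1%N isT.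
  split; apply: up.
    by have := b0 x; rewrite /= /q' opprK mulrC.
  by have := b1 x; rewrite derive1n1 D1 opprK mulrC.
split; apply: is_derive1_eps => e e0; have := main e e0 => /nbhs_ballP[d /= d0 hd];
  exists d => // y yd yt0; have := hd y; rewrite /ball/= distrC => /(_ yd yt0)[//].
Unshelve. all: end_near. Qed.

End solution.
End time_regularity.

Theorem theorem2 (R : realType) (k : nat) (hk : (2 <= k)%N) (a b c : R)
    (T s : R) (hT : 0 < T) (hs : 5 / 2 < s)
    (u : R -> R -> R) (hu : kabc_strong_solution k a b c s T u)
    (u0 : R -> R) (hu0 : forall x : R, u0 x = u 0 x)
    (theta : R) (htheta0 : 0 < theta) (htheta1 : theta < 1)
    (hdecay : exp_decay theta u0) (hdecay' : exp_decay theta (derive1 u0)) :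
  exp_decay_uniform [set` `[0, T]] theta u /\
  exp_decay_uniform [set` `[0, T]] theta (fun t => derive1 (u t)).
Proof.
have u0E : u0 = u 0 by apply/funext.
have [P P1 uC2] := slices_C2_bounded hs hu.
apply: (kabc_persistence hk hT P1 htheta0 htheta1 uC2).
- by move=> x; have [h _] := slice_time_continuous hs hu x; exact: h.
- by move=> x; have [_ h] := slice_time_continuous hs hu x; exact: h.
- by move=> x t tT; have [h _] := slice_time_derivative hs hu x tT; exact: h.
- by move=> x t tT; have [_ h] := slice_time_derivative hs hu x tT; exact: h.
- by rewrite -u0E.
- by rewrite -u0E.
Qed.
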